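(* Let $\alpha\in\mathbb R^{\mathbf I}$ with $\alpha_i>0$ for all $i$, and let $(R,A)$ be the first-order data of the limit network, such that the static planning problem for $(R,A)$ has a unique optimal solution $(\rho^*,x^* )$ with $\rho^*=1$ and its dual has a unique optimal solution $(y^*,z^* )$, which is nonnegative. Let $(\bar Z,\bar T)$ be a fluid model solution under the maximum pressure policy with parameter $\alpha$ (as defined in the context) with $|\bar Z(0)|\le1$ (max norm). Put $\bar W(t)=y^*\cdot\bar Z(t)$ and $\zeta_i^\alpha=\dfrac{y_i^*/\alpha_i}{\sum_{i'}(y_{i'}^* )^2/\alpha_{i'}}$. Then there exists a finite $\tau_0>0$, depending only on $\alpha,\mathbf I,R$ and $A$ (not on the solution), such that $$|\bar Z(t)-\zeta^\alpha\bar W(t)|=0\quad\text{for all }t\ge\tau_0.$$ Furthermore, if $|\bar Z(\tau_1)-\zeta^\alpha\bar W(\tau_1)|=0$ for some $\tau_1\ge0$, then $|\bar Z(t)-\zeta^\alpha\bar W(t)|=0$ for all $t\ge\tau_1$.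
   Context: **Data.** Buffers $\mathcal I=\{1,\dots,\mathbf I\}$ plus an outside buffer $0$; activities $\mathcal J=\{1,\dots,\mathbf J\}=\mathcal J_I\cup\mathcal J_S$ (input, service; disjoint, $\mathcal J_I\ne\emptyset$); processors $\mathcal K=\mathcal K_I\cup\mathcal K_S$ (input, service; disjoint). $A=(A_{kj})$ is a $\mathbf K\times\mathbf J$ 0-1 matrix, every column nonzero, with $A_{kj}=1$ only if $j\in\mathcal J_I,k\in\mathcal K_I$ or $j\in\mathcal J_S,k\in\mathcal K_S$. $B_{ji}\in\{0,1\}$, $\mathcal B_j=\{i\in\mathcal I\cup\{0\}:B_{ji}=1\}\neq\emptyset$, with $\mathcal B_j=\{0\}$ for $j\in\mathcal J_I$ and $0\notin\mathcal B_j$ for $j\in\mathcal J_S$. For $i\in\mathcal B_j$, $(P^j_{ii'})_{i'\in\mathcal I}$ is a nonnegative vector with sum $\le1$; $\mu_j>0$. $R_{ij}=\mu_j(B_{ji}-\sum_{i'\in\mathcal B_j}P^j_{i'i})$ for $i\in\mathcal I,j\in\mathcal J$. $\mathcal A=\{a\in\mathbb R_+^{\mathbf J}:\sum_jA_{kj}a_j\le1\ \forall k\in\mathcal K,\ \sum_jA_{kj}a_j=1\ \forall k\in\mathcal K_I\}$ (a bounded convex set); $\mathcal E$ is its set of extreme points; $x\times y$ is the componentwise product. **Static planning problem.** Minimize $\rho$ over $(\rho,x)$ subject to $Rx=0$; $\sum_jA_{kj}x_j=1$ for $k\in\mathcal K_I$; $\sum_jA_{kj}x_j\le\rho$ for $k\in\mathcal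 K_S$; $x\ge0$. **Dual:** maximize $\sum_{k\in\mathcal K_I}z_k$ over $(y,z)\in\mathbb R^{\mathbf I}\times\mathbb R^{\mathbf K}$ subject to $\sum_iy_iR_{ij}\le-\sum_{k\in\mathcal K_I}z_kA_{kj}$ for $j\in\mathcal J_I$; $\sum_iy_iR_{ij}\le\sum_{k\in\mathcal K_S}z_kA_{kj}$ for $j\in\mathcal J_S$; $\sum_{k\in\mathcal K_S}z_k=1$; $z_k\ge0$ for $k\in\mathcal K_S$. **Fluid model solution under the maximum pressure policy with parameter $\alpha$:** functions $\bar Z:[0,\infty)\to\mathbb R^{\mathbf I}$, $\bar T:[0,\infty)\to\mathbb R^{\mathbf J}$ such that $\bar Z(t)=\bar Z(0)-R\bar T(t)$ and $\bar Z(t)\ge0$ for $t\ge0$; for all $0\le s\le t$, $\sum_jA_{kj}(\bar T_j(t)-\bar T_j(s))=t-s$ for each $k\in\mathcal K_I$ and $\le t-s$ for each $k\in\mathcal K$; $\bar T$ is nondecreasing with $\bar T(0)=0$; and at each $t>0$ at which $(\bar Z,\bar T)$ is differentiable (a regular time), $R\dot{\bar T}(t)\cdot(\alpha\times\bar Z(t))=\max_{a\in\mathcal E}Ra\cdot(\alpha\times\bar Z(t))$. *)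

(* Defs.v *)
From HB Require Import structures.
From mathcomp Require Import all_boot all_order all_algebra.
From mathcomp Require Import all_classical all_reals all_analysis.

Set Implicit Arguments.
Unset Strict Implicit.
Unset Printing Implicit Defensive.

Import Order.TTheory GRing.Theory Num.Theory.
Import numFieldNormedType.Exports.

Local Open Scope classical_set_scope.
Local Open Scope ring_scope.

(* Buffers are 'I_nI, and option 'I_nI adds the outside buffer as None.
   Service activities and service processors are the complements of
   input_act and input_proc. *)
Record network (R : realType) (nI nJ nK : nat) := Network {
  input_act : {set 'I_nJ};
  input_proc : {set 'I_nK};
  capacity : 'M[R]_(nK, nJ);                           (* A *)
  constituency : 'I_nJ -> option 'I_nI -> bool;        (* B *)
  routing : 'I_nJ -> option 'I_nI -> 'I_nI -> R;       (* P^j_{i i'} *)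
  rate : 'I_nJ -> R                                    (* mu *)
}.

Section Network.
Context {R : realType} {nI nJ nK : nat}.
Variable N : network R nI nJ nK.

Local Notation A := (capacity N).
Local Notation B := (constituency N).
Local Notation P := (routing N).
Local Notation mu := (rate N).
Local Notation JI := (input_act N).
Local Notation KI := (input_proc N).

Record network_axioms : Prop := NetworkAxioms {
  input_act_neq0 : exists j, j \in JI;
  capacity01 : forall k j, A k j = 0 \/ A k j = 1;
  capacity_col_neq0 : forall j, exists k, A k j != 0;
  capacity_compat : forall k j, A k j = 1 -> (j \in JI) = (k \in KI);
  constituency_neq0 : forall j, exists i, B j i;
  constituency_input : forall j, j \in JI -> forall i, B j i = (i == None);
  constituency_service : forall j, j \notin JI -> ~~ B j None;
  routing_ge0 : forall j i, B j i -> forall i', 0 <= P j i i';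
  routing_sum_le1 : forall j i, B j i -> \sum_(i' < nI) P j i i' <= 1;
  rate_gt0 : forall j, 0 < mu j
}.

(* Input-output matrix; the sum ranges over option 'I_nI, so it
   includes the routing out of the outside buffer. *)
Definition io_matrix : 'M[R]_(nI, nJ) :=
  \matrix_(i < nI, j < nJ)
    (mu j * ((B j (Some i))%:R - \sum_(i' : option 'I_nI | B j i') P j i' i)).

Definition allocations : set 'cV[R]_nJ :=
  [set a | [/\ forall j, 0 <= a j 0,
              forall k, \sum_(j < nJ) A k j * a j 0 <= 1
            & forall k, k \in KI -> \sum_(j < nJ) A k j * a j 0 = 1]].

Definition planning_feasible : set (R * 'cV[R]_nJ) :=
  [set p | [/\ io_matrix *m p.2 = 0,
              forall k, k \in KI -> \sum_(j < nJ) A k j * p.2 j 0 = 1,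
              forall k, k \notin KI -> \sum_(j < nJ) A k j * p.2 j 0 <= p.1
            & forall j, 0 <= p.2 j 0]].

Definition planning_optimal : set (R * 'cV[R]_nJ) :=
  [set p | planning_feasible p /\
           forall q, planning_feasible q -> p.1 <= q.1].

Definition dual_feasible : set ('cV[R]_nI * 'cV[R]_nK) :=
  [set p : 'cV[R]_nI * 'cV[R]_nK |
          [/\ forall j, j \in JI ->
                 \sum_(i < nI) p.1 i 0 * io_matrix i j
                   <= - \sum_(k < nK | k \in KI) p.2 k 0 * A k j,
              forall j, j \notin JI ->
                 \sum_(i < nI) p.1 i 0 * io_matrix i j
                   <= \sum_(k < nK | k \notin KI) p.2 k 0 * A k j,
              \sum_(k < nK | k \notin KI) p.2 k 0 = 1
            & forall k, k \notin KI -> 0 <= p.2 k 0]].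

Definition dual_value (p : 'cV[R]_nI * 'cV[R]_nK) : R :=
  \sum_(k < nK | k \in KI) p.2 k 0.

Definition dual_optimal : set ('cV[R]_nI * 'cV[R]_nK) :=
  [set p | dual_feasible p /\
           forall q, dual_feasible q -> dual_value q <= dual_value p].

End Network.

Definition extreme_points (R : realType) (V : lmodType R) (S : set V) : set V :=
  [set a | S a /\
    forall (b c : V) (l : R), S b -> S c -> 0 < l < 1 ->
      a = l *: b + (1 - l) *: c -> b = a /\ c = a].

Definition is_maximum (R : realType) (S : set R) (m : R) : Prop :=
  S m /\ ubound S m.

Definition dotprod (R : realType) (n : nat) (u v : 'cV[R]_n) : R :=
  \sum_(i < n) u i 0 * v i 0.

Definition cmul (R : realType) (n : nat) (u v : 'cV[R]_n) : 'cV[R]_n :=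
  \col_(i < n) (u i 0 * v i 0).

Section Fluid.
Context {R : realType} {nI nJ nK : nat}.
Variables (N : network R nI nJ nK) (alpha : 'cV[R]_nI).

(* Trajectories are functions on all of R; only their values at times t >= 0
   are constrained, and derivatives are only taken at t > 0. *)
Record fluid_solution (Z : R -> 'cV[R]_nI) (T : R -> 'cV[R]_nJ) : Prop :=
  FluidSolution {
  fluid_balance : forall t : R, 0 <= t -> Z t = Z 0 - io_matrix N *m T t;
  fluid_ge0 : forall t : R, 0 <= t -> forall i, 0 <= Z t i 0;
  fluid_input_busy : forall s t : R, 0 <= s -> s <= t ->
    forall k, k \in input_proc N ->
      \sum_(j < nJ) capacity N k j * (T t j 0 - T s j 0) = t - s;
  fluid_capacity : forall s t : R, 0 <= s -> s <= t ->
    forall k, \sum_(j < nJ) capacity N k j * (T t j 0 - T s j 0) <= t - s;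
  fluid_nondecreasing : forall s t : R, 0 <= s -> s <= t ->
    forall j, T s j 0 <= T t j 0;
  fluid_start : T 0 = 0;
  fluid_max_pressure : forall t : R, 0 < t -> derivable Z t 1 -> derivable T t 1 ->
    is_maximum
      [set dotprod (io_matrix N *m a) (cmul alpha (Z t))
         | a in extreme_points (allocations N)]
      (dotprod (io_matrix N *m 'D_1 T t) (cmul alpha (Z t)))
}.

End Fluid.

Definition workload (R : realType) (nI : nat) (y : 'cV[R]_nI)
    (Z : R -> 'cV[R]_nI) (t : R) : R := dotprod y (Z t).

Definition lifting (R : realType) (nI : nat) (alpha y : 'cV[R]_nI) : 'cV[R]_nI :=
  \col_(i < nI)
    ((y i 0 / alpha i 0) / \sum_(i' < nI) (y i' 0 ^+ 2 / alpha i' 0)).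

(* Main.v *)
(* Write W = ys . Z and let q = Z - W zeta be the component of Z orthogonal to
   zeta for the inner product weighted by alpha.  The Lyapunov function is
   phi = sum_i alpha_i q_i^2 = sum_i alpha_i Z_i^2 - W^2 / sum_i (ys_i^2 / alpha_i).
   LP duality gives ys . R a <= 0 on allocations, so W is nondecreasing and
   phi' <= -2 max_a (R a . (alpha x Z)) at regular times.  Uniqueness of the dual
   optimum shows, by Farkas' lemma, that every direction orthogonal to ys is a
   nonnegative multiple of R a for some allocation a, whence the maximum is at least
   kappa sqrt phi.  Thus sqrt phi decreases at rate kappa until it vanishes.
   These differential inequalities hold only at regular times; they integrate
   because Lipschitz functions are almost everywhere differentiable and are
   integrals of their derivatives, by Radon-Nikodym applied to the
   Lebesgue-Stieltjes measure and Lebesgue differentiation. *)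

Require Import Defs.
From HB Require Import structures.
From mathcomp Require Import all_boot all_order all_algebra.
From mathcomp Require Import all_classical all_reals all_analysis.
From mathcomp Require Import ring lra.

Set Implicit Arguments.
Unset Strict Implicit.
Unset Printing Implicit Defensive.

Import Order.TTheory GRing.Theory Num.Theory.
Import numFieldNormedType.Exports.

Local Open Scope classical_set_scope.
Local Open Scope ring_scope.

(** * Lipschitz functions are integrals of their derivatives *)

(** Both [F] and [x - F x] are nondecreasing, and their Stieltjes measures add up to Lebesgue
    measure. The measure of [F] is therefore dominated by Lebesgue measure, and [h] is its
    Radon-Nikodym density. *)
Lemma nondecreasing_shrinking_integral (R : realType) (F : R -> R) (a b : R) :
  (forall x y, x <= y -> 0 <= F y - F x <= y - x) ->
  exists h : R -> R,
    [/\ forall x, 0 <= h x, lebesgue_measure.-integrable setT (EFin \o h) &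
      forall x, a <= x <= b ->
        F x - F a = (\int[lebesgue_measure]_(t in `]a, x]) h t)%R].
Proof.
move=> F01.
have ndF : {homo F : x y / x <= y}.
  by move=> x y /F01/andP[+ _]; rewrite subr_ge0.
have ndG : {homo (fun x => x - F x) : x y / x <= y}.
  by move=> x y /F01/andP[_]; lra.
have cF : continuous F.
  move=> x; apply/cvgrPdist_le => e e0; near=> y.
  have : `|x - y| <= e.
    near: y; exists e => // y /= /ltW.
    exact.
  apply: le_trans.
  case: (leP x y) => [|/ltW] xy; have /andP[h1 h2] := F01 _ _ xy.
    by rewrite distrC ger0_norm// distrC ger0_norm// subr_ge0.
  by rewrite ger0_norm// ger0_norm// subr_ge0.
have rF : forall x, F @ at_right x --> F x by exact: right_continuousW.
have rG : forall x, (fun x => x - F x) @ at_right x --> x - F x.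
  apply: (@right_continuousW _ _ _ (fun x => x - F x)) => x.
  by apply: (@cvgB _ R^o); [exact: cvg_id|exact: cF].
pose F_cum := isCumulative.Build R _ R F ndF rF.
pose G_cum := isCumulative.Build R _ R (fun x => x - F x) ndG rG.
pose cuF : cumulative R R := HB.pack F F_cum.
pose cuG : cumulative R R := HB.pack (fun x : R => x - F x) G_cum.
pose mF := lebesgue_stieltjes_measure cuF.
pose mG := lebesgue_stieltjes_measure cuG.
have lsE (cu : cumulative R R) (x y : R) : x <= y ->
    lebesgue_stieltjes_measure cu (`]x, y])%classic = (cu y - cu x)%:E.
  move=> xy.
  rewrite /lebesgue_stieltjes_measure/= /measure_extension/= measurable_mu_extE/=.
    by rewrite wlength_itv_bnd.
  exact: is_ocitv.
(* hence the measure of F is absolutely continuous *)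
have sumE A : measurable A -> lebesgue_measure A = (mF A + mG A)%E.
  move=> mA; transitivity (measure_add mF mG A); last exact: measure_addE.
  apply: lebesgue_measure_unique => // X /ocitvP[->|[[x y] /= xy ->]].
    by rewrite !measure0.
  transitivity (mF `]x, y]%classic + mG `]x, y]%classic)%E; last first.
    exact/esym/measure_addE.
  rewrite /lebesgue_measure /mF /mG !lsE ?ltW//=.
  by rewrite -EFinD; congr EFin; lra.
(* Cutting the measure down to []a, b]] makes it finite, as the Radon-Nikodym step requires. *)
have mFoo : (mF (`]a, b])%classic < +oo)%E.
  have [ab|ba] := leP a b; first by rewrite /mF lsE// ltry.
  have -> : `]a, b]%classic = set0 by apply: set_itv_ge; rewrite bnd_simp -leNgt ltW.
  by rewrite /mF measure0 ltry.
have mab : measurable (`]a, b]%classic : set (measurableTypeR R)).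
  exact: measurable_itv.
pose nu : {finite_measure set (measurableTypeR R) -> \bar R} := mfrestr mab mFoo.
have nudom : nu `<< (@lebesgue_measure R).
  apply/null_content_dominatesP => A mA A0.
  rewrite /nu/= /mfrestr /mrestr/=; apply/eqP; rewrite eq_le measure_ge0 andbT.
  rewrite -A0 [leRHS](sumE _ mA).
  apply: (@le_trans _ _ (mF A)); last by rewrite leeDl.
  by rewrite le_measure ?inE//; exact: measurableI.
have [f [f0 ffin intf nuE]] := radon_nikodym_sigma_finite nudom.
exists (fine \o f); split => [x||]; first exact: fine_ge0.
  apply: eq_integrable intf => // x _ /=.
  by rewrite fineK.
move=> x /andP[ax xb].
rewrite /Rintegral; under eq_integral do rewrite /= fineK//.
have mx : measurable (`]a, x]%classic : set (measurableTypeR R)).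
  exact: measurable_itv.
rewrite -nuE// /nu/= /mfrestr /mrestr/= setIidl; first by rewrite /mF lsE.
by apply: subset_itvl; rewrite bnd_simp.
Unshelve. all: by end_near. Qed.

Lemma is_derive_near_affine (R : realType) (f g : R -> R) (k l c x : R) :
  {near x, (fun y => k * f y + l * y + c) =1 g} -> derivable f x 1 ->
  is_derive x 1 g (k * 'D_1 f x + l).
Proof.
move=> fg df.
have dd : is_derive x 1 (fun y => k * f y + l * y + c) (k * 'D_1 f x + l).
  have d1 : is_derive x (1:R) (k *: f) (k *: 'D_1 f x).
    by apply: is_deriveZ; exact/derivableP.
  have d2 : is_derive x (1:R) (l *: @id R) (l *: (1:R)) by apply: is_deriveZ.
  have d3 := is_deriveD (is_deriveD d1 d2) (is_derive_cst c x (1:R)).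
  by apply: is_derive_eq d3 _; rewrite /GRing.scale/= mulr1 addr0.
by apply: near_eq_is_derive fg dd.
Qed.

(** By Lebesgue differentiation the indefinite integral of [h] has derivative [h] almost everywhere,
    and near interior points [F] differs from it by the constant [F a]. *)
Lemma nondecreasing_shrinking_derivable_ae (R : realType) (F : R -> R) (a b : R) :
  (forall x y, x <= y -> 0 <= F y - F x <= y - x) -> a <= b ->
  exists h : R -> R,
    [/\ forall x, 0 <= h x, lebesgue_measure.-integrable setT (EFin \o h),
      F b - F a = (\int[lebesgue_measure]_(t in `]a, b]) h t)%R &
      {ae lebesgue_measure, forall x, x \in `]a, b[%R ->
         derivable F x 1 /\ 'D_1 F x = h x}].
Proof.
move=> F01 ab; have [h [h0 inth hE]] := nondecreasing_shrinking_integral a b F01.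
exists h; split => //; first by rewrite hE// ab lexx.
have mS (S : set R) : measurable S -> lebesgue_measure.-integrable S (EFin \o h).
  by move=> mS; exact: integrableS inth.
have := @FTC1 R h (BRight a) (fun y => mS _ (measurable_itv _))
  (open_integrable_locally openT inth).
apply: filterS => [|x /(_ _)+ xab]; first exact: (ae_filter_ringOfSetsType lebesgue_measure).
move: (xab); rewrite in_itv/= => /andP[ax xb].
move=> /(_ ax)[dI]; rewrite derive1E => DI.
pose I := fun y => (\int[lebesgue_measure]_(t in `]a, y]) h t)%R.
have nFI : {near x, (fun y => 1 * I y + 0 * y + F a) =1 F}.
  near=> y; rewrite /I mul1r mul0r addr0 -hE ?subrK//.
  have : y \in `]a, b[ by near: y; exact: near_in_itvoo.
  by rewrite in_itv/= => /andP[/ltW-> /ltW->].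
have dF := is_derive_near_affine nFI dI.
split; [exact: ex_derive|rewrite (@derive_val _ _ _ _ _ _ _ dF)].
by rewrite DI mul1r addr0.
Unshelve. all: by end_near. Qed.

(** The increments of [(G x + L x) / (2 L)] lie between 0 and those of [x], which reduces to the
    monotone case. The bound [- L <= h] holds everywhere, so a constant shift makes [h]
    nonnegative. *)
Lemma lipschitz_derivable_ae (R : realType) (G : R -> R) (a b L : R) :
  0 < L -> a <= b ->
  {in `[a, b] &, forall x y, `|G y - G x| <= L * `|y - x|} ->
  exists h : R -> R,
    [/\ forall x, - L <= h x, lebesgue_measure.-integrable `]a, b] (EFin \o h),
      G b - G a = (\int[lebesgue_measure]_(t in `]a, b]) h t)%R &
      {ae lebesgue_measure, forall x, x \in `]a, b[%R ->
         derivable G x 1 /\ 'D_1 G x = h x}].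
Proof.
move=> L0 ab Glip.
(* [k] retracts the line onto [[a, b]]; composing with it extends the function to the whole line
   with the same bounds on increments. *)
pose k (x : R) := Num.min (Num.max a x) b.
have kin x : k x \in `[a, b].
  by rewrite in_itv/= /k le_min ab ge_min le_max !lexx/= orbT.
have kid x : x \in `[a, b] -> k x = x.
  by rewrite in_itv/= => /andP[ax xb]; rewrite /k (max_idPr ax) (min_idPl xb).
have kmono x y : x <= y -> 0 <= k y - k x <= y - x.
  by move=> xy; rewrite /k; case: (leP a x) => ax; case: (leP a y) => ay;
    rewrite ?(min_idPl ab); case: (leP x b) => xb; case: (leP y b) => yb; lra.
pose F x := (2 * L)^-1 * (G (k x) + L * k x).
have L20 : 0 < 2 * L by rewrite mulr_gt0.
have F01 x y : x <= y -> 0 <= F y - F x <= y - x.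
  move=> /kmono/andP[k0 kxy]; have := Glip _ _ (kin x) (kin y).
  rewrite (ger0_norm k0) ler_norml => /andP[h1 h2].
  have -> : F y - F x = (G (k y) - G (k x) + L * (k y - k x)) / (2 * L).
    by rewrite /F; ring.
  apply/andP; split; first by rewrite divr_ge0 ?(ltW L20)//; lra.
  rewrite ler_pdivrMr//; apply: (@le_trans _ _ (2 * L * (k y - k x))); first by lra.
  by rewrite mulrC ler_wpM2r ?(ltW L20).
have [h [h0 inth FE aeF]] := nondecreasing_shrinking_derivable_ae F01 ab.
have GE x : x \in `[a, b] -> G x = 2 * L * F x - L * x.
  by move=> xab; rewrite /F kid// mulrA mulfV ?gt_eqF// mul1r addrK.
have mab : measurable (`]a, b]%classic : set (measurableTypeR R)) by [].
have inthab : lebesgue_measure.-integrable (`]a, b]%classic) (EFin \o h).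
  exact: integrableS inth.
have intL : lebesgue_measure.-integrable (`]a, b]%classic) (EFin \o cst L).
  apply/integrableP; split; first by apply/measurable_realfun.measurable_EFinP.
  under eq_integral do rewrite /= gtr0_norm//.
  rewrite integral_cst//= lebesgue_measure_itv/=.
  by case: ifP; rewrite ?mule0 -?EFinM ltry.
have int2 : lebesgue_measure.-integrable (`]a, b]%classic)
    (EFin \o (fun x => 2 * L * h x)).
  have := integrableZl mab (2 * L) inthab.
  exact: eq_integrable.
exists (fun x => 2 * L * h x - L); split.
- by move=> x; rewrite lerDr mulr_ge0// ltW.
- by apply: eq_integrable (integrableB mab int2 intL).
- rewrite (RintegralB mab int2 intL) RintegralZl// -FE Rintegral_cst//.
  rewrite [X in fine X](_ : _ = (b - a)%:E)/=; last first.
    transitivity (lebesgue_measure (`]a, b]%classic : set R)) => //.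
    rewrite lebesgue_measure_itv/= lte_fin.
    by case: ltgtP ab => // -> _; rewrite subrr.
  by rewrite !GE ?in_itv/= ?lexx ?ab//; ring.
- apply: filterS aeF => [|x + xab /=]; first exact: (ae_filter_ringOfSetsType lebesgue_measure).
  move=> /(_ xab)[dF DF].
  have nFG : {near x, (fun y => 2 * L * F y + - L * y + 0) =1 G}.
    near=> y; rewrite GE ?mulNr ?addr0//; apply: subset_itv_oo_cc.
    by near: y; exact: near_in_itvoo.
  have dG := is_derive_near_affine nFG dF.
  split; [exact: ex_derive|rewrite (@derive_val _ _ _ _ _ _ _ dG)].
  by rewrite DF.
Unshelve. all: by end_near. Qed.

Definition lipschitz_itv (R : realType) (a b : R) (f : R -> R) :=
  exists2 L, 0 <= L & {in `[a, b] &, forall x y, `|f y - f x| <= L * `|y - x|}.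

(** A mean value inequality for a bound on the derivative known only where [u] is differentiable:
    almost every point is such, and [g] is the integral of its derivative. With [u] the activity
    process these are the regular times. *)
Lemma lipschitz_derive_le (R : realType) (m n : nat) (u : R -> 'M[R]_(m, n))
    (g : R -> R) (a b c : R) :
  a <= b -> (forall i j, lipschitz_itv a b (fun x => u x i j)) ->
  lipschitz_itv a b g ->
  {in `]a, b[, forall x, derivable u x 1 -> derivable g x 1 /\ 'D_1 g x <= c} ->
  g b - g a <= c * (b - a).
Proof.
move=> ab ulip [L L0 glip] ug.
have lipW (f : R -> R) (k k' : R) : k <= k' ->
    {in `[a, b] &, forall x y, `|f y - f x| <= k * `|y - x|} ->
    {in `[a, b] &, forall x y, `|f y - f x| <= k' * `|y - x|}.
  move=> kk' fk x y xab yab; apply: le_trans (fk x y xab yab) _.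
  by rewrite ler_wpM2r.
(* [K] exceeds both [L] and [- c], so [h + K] and [c + K] are nonnegative and the almost everywhere
   comparison of nonnegative integrals applies to them. *)
pose K := L + `|c| + 1.
have K0 : 0 < K by rewrite ltr_wpDl// addr_ge0.
have LK : L <= K by rewrite /K -addrA lerDl addr_ge0.
have [h [hK inth -> aeg]] := lipschitz_derivable_ae K0 ab (lipW _ _ _ LK glip).
have aeu : {ae lebesgue_measure, forall x, x \in `]a, b[%R -> derivable u x 1}.
  have aeu : {ae lebesgue_measure, forall x (ij : 'I_m * 'I_n), x \in `]a, b[%R ->
      derivable (fun y => u y ij.1 ij.2) x 1}.
    apply: filter_forall => -[i j] /=.
    have [k k0 uk] := ulip i j.
    have k1 : 0 < k + 1 by rewrite ltr_wpDl.
    have kk : k <= k + 1 by rewrite lerDl.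
    have [h' [_ _ _ aek]] := lipschitz_derivable_ae k1 ab (lipW _ _ _ kk uk).
    apply: filterS aek => [|x + xab]; first exact: (ae_filter_ringOfSetsType lebesgue_measure).
    by move=> /(_ xab)[].
  apply: filterS aeu => [|x + xab]; first exact: (ae_filter_ringOfSetsType lebesgue_measure).
  by move=> ux; apply/derivable_mxP => i j; exact: (ux (i, j)).
have aeh : {ae lebesgue_measure, forall x, `]a, b[%classic x -> h x <= c}.
  apply: filterS2 aeg aeu => [|x + + xab]; first exact: (ae_filter_ringOfSetsType lebesgue_measure).
  have {}xab : x \in `]a, b[%R by [].
  by move=> /(_ xab)[_ <-] /(_ xab)/(ug _ xab)[].
have mab : measurable (`]a, b[%classic : set (measurableTypeR R)) by [].
have inth' : lebesgue_measure.-integrable (`]a, b[%classic : set (measurableTypeR R)) (EFin \o h).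
  apply: integrableS inth => //; exact: subset_itv_oo_oc.
rewrite -Rintegral_itv_bndo_bndc//.
have muab : lebesgue_measure (`]a, b[%classic : set (measurableTypeR R)) = (b - a)%:E.
  transitivity (lebesgue_measure (`]a, b[%classic : set R)) => //.
  rewrite lebesgue_measure_itv/= lte_fin.
  by case: ltgtP ab => // -> _; rewrite subrr.
have intc (k : R) : lebesgue_measure.-integrable (`]a, b[%classic : set (measurableTypeR R)) (EFin \o cst k).
  apply/integrableP; split; first by apply/measurable_realfun.measurable_EFinP.
  under eq_integral do rewrite /=.
  by rewrite integral_cst//= [X in (_ * X)%E]muab -?EFinM ltry.
suff : (\int[lebesgue_measure]_(x in `]a, b[) (h x + K) <=
        \int[lebesgue_measure]_(x in `]a, b[) (c + K))%R.
  rewrite (RintegralD mab inth' (intc K)) (RintegralD mab (intc c) (intc K)) lerD2r.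
  by rewrite Rintegral_cst// [X in _ <= _ * fine X]muab.
have inthK : lebesgue_measure.-integrable (`]a, b[%classic : set (measurableTypeR R))
    (fun x => (h x + K)%:E) by apply: eq_integrable (integrableD mab inth' (intc K)).
have hK0 x : 0 <= h x + K by rewrite -lerBlDr sub0r.
rewrite /Rintegral fine_le//.
- exact: integrable_fin_num inthK.
- exact: integrable_fin_num (intc (c + K)).
apply: ae_ge0_le_integral => //.
- by move=> x _; rewrite lee_fin.
- by have /integrableP[] := inthK.
- move=> x _; rewrite lee_fin /K.
  have := ler_norm (- c); rewrite normrN; lra.
apply: filterS aeh => [|x + xab]; first exact: (ae_filter_ringOfSetsType lebesgue_measure).
by move=> /(_ xab); rewrite lee_fin lerD2r.
Qed.

(** * Closure properties of Lipschitz functions on an interval *)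

Section LipschitzItv.
Context {R : realType} (a b : R).
Implicit Types f g : R -> R.

Lemma eq_lipschitz_itv f g : {in `[a, b], f =1 g} ->
  lipschitz_itv a b f -> lipschitz_itv a b g.
Proof.
by move=> fg [L L0 fL]; exists L => // x y xab yab; rewrite -!fg//; exact: fL.
Qed.

Lemma lipschitz_itv_cst (c : R) : lipschitz_itv a b (fun=> c).
Proof. by exists 0 => // x y _ _; rewrite subrr normr0 mul0r. Qed.

Lemma lipschitz_itvD f g : lipschitz_itv a b f -> lipschitz_itv a b g ->
  lipschitz_itv a b (fun x => f x + g x).
Proof.
move=> [k k0 fk] [l l0 gl]; exists (k + l); first exact: addr_ge0.
move=> x y xab yab; rewrite mulrDl opprD addrACA.
by apply: le_trans (ler_normD _ _) _; rewrite lerD ?fk ?gl.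
Qed.

Lemma lipschitz_itvM f g : lipschitz_itv a b f -> lipschitz_itv a b g ->
  lipschitz_itv a b (fun x => f x * g x).
Proof.
have bnd h : lipschitz_itv a b h ->
    exists2 B, 0 <= B & {in `[a, b], forall x, `|h x| <= B}.
  move=> [k k0 hk]; exists (`|h a| + k * `|b - a|).
    by rewrite addr_ge0 ?mulr_ge0.
  move=> x xab; have := xab; rewrite in_itv/= => /andP[ax xb].
  have aab : a \in `[a, b] by rewrite in_itv/= lexx (le_trans ax xb).
  rewrite -[h x](subrK (h a)) addrC; apply: le_trans (ler_normD _ _) _.
  rewrite lerD2l (le_trans (hk _ _ aab xab))// ler_wpM2l//.
  by rewrite !ger0_norm ?subr_ge0 ?lerD2r// (le_trans ax xb).
move=> fL gL; have [B B0 fB] := bnd f fL; have [C C0 gC] := bnd g gL.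
case: fL gL => k k0 fk [l l0 gl].
exists (B * l + C * k); first by rewrite addr_ge0 ?mulr_ge0.
move=> x y xab yab.
have -> : f y * g y - f x * g x = f y * (g y - g x) + g x * (f y - f x) by ring.
apply: le_trans (ler_normD _ _) _; rewrite !normrM mulrDl lerD// -mulrA.
  by rewrite ler_pM ?fB ?gl.
by rewrite ler_pM ?gC ?fk.
Qed.

Lemma lipschitz_itv_sum (I : finType) (f : I -> R -> R) :
  (forall i, lipschitz_itv a b (f i)) -> lipschitz_itv a b (fun x => \sum_i f i x).
Proof.
move=> fL; suff H (s : seq I) : lipschitz_itv a b (fun x => \sum_(i <- s) f i x).
  exact: H.
elim: s => [|i s IH].
  rewrite (_ : (fun _ => _) = fun=> 0); first exact: lipschitz_itv_cst.
  by apply/funext => x; rewrite big_nil.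
rewrite (_ : (fun _ => _) = fun x => f i x + \sum_(i <- s) f i x).
  exact: lipschitz_itvD.
by apply/funext => x; rewrite big_cons.
Qed.

(** A difference of roots is the difference of the values divided by the sum of the roots, and this
    sum is at least the root of [m]. *)
Lemma lipschitz_itv_sqrt f (m : R) : 0 < m -> {in `[a, b], forall x, m <= f x} ->
  lipschitz_itv a b f -> lipschitz_itv a b (fun x => Num.sqrt (f x)).
Proof.
move=> m0 fm [k k0 fk]; have sm : 0 < Num.sqrt m by rewrite sqrtr_gt0.
exists (k / Num.sqrt m); first by rewrite divr_ge0 ?(ltW sm).
move=> x y xab yab; rewrite mulrAC ler_pdivlMr//.
apply: le_trans (fk x y xab yab).
have sq t : t \in `[a, b] -> f t = Num.sqrt (f t) ^+ 2.
  by move=> tab; rewrite sqr_sqrtr// (le_trans (ltW m0))// fm.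
rewrite [in leRHS](sq y)// [in leRHS](sq x)// subr_sqr normrM ler_wpM2l//.
rewrite ger0_norm ?addr_ge0 ?sqrtr_ge0// (le_trans (y := Num.sqrt (f y)))//.
  by apply: ler_wsqrtr; exact: fm.
by rewrite lerDl sqrtr_ge0.
Qed.

End LipschitzItv.

(** * Farkas' lemma *)

(* Bartl's algebraic proof: if dropping the generator i0 breaks the implication,
   a point x0 witnessing this lets one project every form onto the kernel of
   the form i0, along x0. *)
Lemma farkas_seq (R : realFieldType) (X : finType) (I : eqType) (s : seq I)
    (g : I -> X -> R) (gam : X -> R) :
  uniq s ->
  (forall x : X -> R, (forall i, i \in s -> \sum_p g i p * x p <= 0) ->
     \sum_p gam p * x p <= 0) ->
  exists2 w : I -> R, forall i, 0 <= w i &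
    forall p, gam p = \sum_(i <- s) w i * g i p.
Proof.
elim: s g gam => [|i0 s IH] g gam.
  (* Without generators the hypothesis applies to [gam] itself and makes its sum of squares
     nonpositive. *)
  move=> _ /(_ gam)/(_ (fun _ _ => ltac:(by []))) H.
  exists (fun=> 0) => // p; rewrite big_nil.
  have : \sum_p gam p * gam p == 0.
    by rewrite eq_le H sumr_ge0// => q _; rewrite -expr2 sqr_ge0.
  rewrite psumr_eq0 => [|q _]; last by rewrite -expr2 sqr_ge0.
  by move=> /allP/(_ p (mem_index_enum p)); rewrite mulf_eq0 orbb => /eqP.
move=> /=/andP[i0s us] H.
have [Hs|] := pselect (forall x : X -> R,
    (forall i, i \in s -> \sum_p g i p * x p <= 0) -> \sum_p gam p * x p <= 0).
  have [w w0 wE] := IH g gam us Hs.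
  exists (fun i => if i == i0 then 0 else w i) => [i|p]; first by case: ifP.
  rewrite big_cons eqxx mul0r add0r wE; apply: eq_big_seq => i si.
  by case: eqP si i0s => // -> ->.
move=> /existsNP[x0 /not_implyP[x0s /negP]]; rewrite -ltNge => gx0.
pose f i x := \sum_p g i p * x p.
have fx0 : 0 < f i0 x0.
  rewrite ltNge; apply/negP => fx0; move: gx0; rewrite ltNge H// => i.
  by rewrite inE => /predU1P[->//|/x0s].
pose d := (f i0 x0)^-1.
pose g' i p := g i p - f i x0 * d * g i0 p.
pose gam' p := gam p - (\sum_p gam p * x0 p) * d * g i0 p.
(* The corrected form at [x] is the original form at the projection of [x], along [x0], onto the
   kernel of the form [i0]. *)
have E (h : X -> R) (x : X -> R) :
    \sum_p (h p - (\sum_p h p * x0 p) * d * g i0 p) * x p =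
    \sum_p h p * (x p - f i0 x * d * x0 p).
  transitivity (\sum_p h p * x p - (\sum_p h p * x0 p) * d * f i0 x).
    by rewrite /f mulr_sumr -sumrB; apply: eq_bigr => p _; ring.
  rewrite -mulrA mulr_suml -sumrB.
  by apply: eq_bigr => p _; ring.
have [|w w0 wE] := IH g' gam' us.
  move=> x xs; rewrite E; apply: H => i; rewrite inE => /predU1P[->|si].
    under eq_bigr do rewrite mulrBr mulrCA.
    rewrite sumrB -mulr_sumr -/(f i0 x) -/(f i0 x0) -mulrA /d mulVf ?gt_eqF//.
    by rewrite mulr1 subrr.
  by rewrite -E xs.
(* This is the weight of [i0]; it is nonnegative because [gam] is positive at [x0], where the other
   generators are nonpositive. *)
have c0 : 0 <= (\sum_p gam p * x0 p - \sum_(i <- s) w i * f i x0) * d.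
  rewrite mulr_ge0 ?invr_ge0 ?(ltW fx0)// subr_ge0 (le_trans _ (ltW gx0))//.
  rewrite big_seq sumr_le0// => i si.
  by rewrite mulr_ge0_le0// x0s.
exists (fun i => if i == i0 then
    (\sum_p gam p * x0 p - \sum_(i <- s) w i * f i x0) * d else w i).
  by move=> i; case: ifP.
move=> p; rewrite big_cons eqxx.
have := wE p; rewrite /gam' => /eqP; rewrite subr_eq => /eqP ->.
have -> : \sum_(i <- s) (if i == i0 then (\sum_p gam p * x0 p -
      \sum_(i <- s) w i * f i x0) * d else w i) * g i p = \sum_(i <- s) w i * g i p.
  by apply: eq_big_seq => i si; case: eqP si i0s => // -> ->.
have -> : \sum_(i <- s) w i * g' i p =
    \sum_(i <- s) w i * g i p - (\sum_(i <- s) w i * f i x0) * (d * g i0 p).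
  by rewrite mulr_suml -sumrB; apply: eq_bigr => i _; rewrite /g'; ring.
by ring.
Qed.

Lemma farkas (R : realFieldType) (X I : finType) (g : I -> X -> R) (gam : X -> R) :
  (forall x : X -> R, (forall i, \sum_p g i p * x p <= 0) ->
     \sum_p gam p * x p <= 0) ->
  exists2 w : I -> R, forall i, 0 <= w i & forall p, gam p = \sum_i w i * g i p.
Proof.
move=> H; apply: farkas_seq (index_enum_uniq _) _ => x xs.
by apply: H => i; exact/xs/mem_index_enum.
Qed.

(** * Extreme points of polyhedra *)

(* From a non-extreme point one can move along a segment direction, in the sense
   increasing l, until one more inequality becomes tight; tight ones stay tight. *)
Lemma polyhedron_extreme_point_ge (R : realType) (V : lmodType R) (I : finType)
    (G : I -> V -> R) (b : I -> R) (l : V -> R) (S : set V) :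
  (forall i, linear_for *%R (G i)) -> linear_for *%R l ->
  (forall d, (forall i, G i d <= 0) -> d = 0) ->
  (forall x, S x <-> forall i, G i x <= b i) ->
  forall x, S x -> exists2 e, extreme_points S e & l x <= l e.
Proof.
move=> Glin llin Grec SE.
(* Induction on the number of slack inequalities, which each move lowers. *)
pose nt (x : V) := #|[pred i | G i x != b i]|.
suff H k : forall x, (nt x < k)%N -> S x -> exists2 e, extreme_points S e & l x <= l e.
  by move=> x; exact: (H (nt x).+1).
elim: k => // k IH x ntx Sx.
have [ex|] := pselect (extreme_points S x); first by exists x.
move=> /not_andP[//|] /existsNP[u] /existsNP[v] /existsNP[c].
move=> /not_implyP[Su] /not_implyP[Sv] /not_implyP[/andP[c0 c1]].
move=> /not_implyP[xE nuv].
have lin0 (f : V -> R) : linear_for *%R f -> f 0 = 0.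
  by move=> fl; have := fl (-1) 0 0; rewrite scaler0 addr0 mulN1r addNr.
have linZ (f : V -> R) a w : linear_for *%R f -> f (a *: w) = a * f w.
  by move=> fl; rewrite -[a *: w]addr0 fl lin0// addr0.
(* An inequality tight at a proper convex combination is tight at both ends, so its form vanishes on
   [u - v]. *)
have tightE i : G i x = b i -> G i (u - v) = 0.
  have -> : u - v = 1 *: u + (-1) *: v by rewrite scale1r scaleN1r.
  rewrite Glin linZ// xE Glin linZ//.
  have /SE/(_ i) := Su; have /SE/(_ i) := Sv; nra.
have uv0 : u - v != 0.
  apply/eqP => /eqP; rewrite subr_eq0 => /eqP uv; apply: nuv.
  by rewrite xE uv -scalerDl addrC subrK scale1r.
have [d [d0 ld dE]] : exists d, [/\ d != 0, 0 <= l d & forall i, G i x = b i -> G i d = 0].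
  have [luv|luv] := leP 0 (l (u - v)); first by exists (u - v).
  exists ((-1) *: (u - v)); split.
  - by rewrite scaler_eq0 oppr_eq0 oner_eq0.
  - by rewrite linZ// mulN1r oppr_ge0 ltW.
  - by move=> i /tightE ti; rewrite linZ// ti mulr0.
(* Otherwise [d] would be a recession direction, hence zero. *)
have [i1 Gi1] : exists i, 0 < G i d.
  apply: contrapT => nG; move/eqP: d0; apply; apply: Grec => i.
  by rewrite leNgt; apply/negP => Gi; apply: nG; exists i.
(* Ratio test: [r i] is the step at which inequality [i] becomes tight, and the smallest such step
   stays in [S]. *)
pose r i := (b i - G i x) / G i d.
have [i0 /= Gi0 i0min] := @arg_minP _ _ _ i1 (fun i => 0 < G i d) r Gi1.
have r0 : 0 <= r i0.
  by rewrite /r divr_ge0 ?(ltW Gi0)// subr_ge0; exact: (SE x).1.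
have GE i : G i (r i0 *: d + x) = r i0 * G i d + G i x by rewrite Glin.
have Sx' : S (r i0 *: d + x).
  apply/SE => i; rewrite GE; have Gx := (SE x).1 Sx i.
  have [Gd|Gd] := leP (G i d) 0; first nra.
  by rewrite -lerBrDr -ler_pdivlMr// i0min.
have [] := IH (r i0 *: d + x) _ Sx'; last first.
  move=> e ee le; exists e => //; apply: le_trans le.
  by rewrite llin lerDr mulr_ge0.
rewrite -ltnS (leq_trans _ ntx)//  ltnS; apply: proper_card; apply/properP; split.
  apply/fintype.subsetP => i; rewrite !inE; apply: contra => /eqP Gi.
  by rewrite GE dE// mulr0 add0r Gi.
exists i0; rewrite !inE.
  by apply/eqP => /dE Gd; rewrite Gd ltxx in Gi0.
rewrite negbK GE /r divfK; last by rewrite gt_eqF.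
by rewrite subrK.
Qed.

(** * Linear programming duality for the network *)

Section NetworkDuality.
Context {R : realType} {nI nJ nK : nat} (N : network R nI nJ nK).
Hypothesis Nax : network_axioms N.

Local Notation A := (capacity N).
Local Notation KI := (input_proc N).
Local Notation JI := (input_act N).

Lemma capacity_ge0 k j : 0 <= A k j.
Proof. by case: (capacity01 Nax k j) => ->. Qed.

Lemma capacity_recession (d : 'cV[R]_nJ) :
  (forall j, 0 <= d j 0) -> (forall k, \sum_(j < nJ) A k j * d j 0 <= 0) -> d = 0.
Proof.
move=> d0 Ad; apply/matrixP => j j0; rewrite (ord1 j0) mxE.
have [k Akj] := capacity_col_neq0 Nax j.
have t0 i : true -> 0 <= A k i * d i 0 by rewrite mulr_ge0// capacity_ge0.
have : \sum_(i < nJ) A k i * d i 0 == 0 by rewrite eq_le Ad sumr_ge0.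
rewrite psumr_eq0// => /allP/(_ j (mem_index_enum _)).
by rewrite mulf_eq0 (negbTE Akj) => /eqP.
Qed.

(** The policy maximizes over extreme points only; this carries its bound over to every
    allocation. *)
Lemma allocation_extreme_ge (l : 'cV[R]_nJ -> R) a :
  linear_for *%R l -> allocations N a ->
  exists2 e, extreme_points (allocations N) e & l a <= l e.
Proof.
move=> llin Aa.
pose cap k (x : 'cV[R]_nJ) := \sum_(j < nJ) A k j * x j 0.
(* Three kinds of inequalities: nonnegativity, capacity, and the reversed capacity bound that gives
   equality at input processors. At service processors the last one reads [0 <= 0]. *)
pose G (i : ('I_nJ + 'I_nK) + 'I_nK) (x : 'cV[R]_nJ) := match i with
  | inl (inl j) => - x j 0
  | inl (inr k) => cap k x
  | inr k => if k \in KI then - cap k x else 0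
  end.
pose b (i : ('I_nJ + 'I_nK) + 'I_nK) : R := match i with
  | inl (inl j) => 0
  | inl (inr k) => 1
  | inr k => if k \in KI then -1 else 0
  end.
have caplin k c x y : cap k (c *: x + y) = c * cap k x + cap k y.
  rewrite /cap mulr_sumr -big_split/=.
  by apply: eq_bigr => j _; rewrite !mxE; ring.
apply: (@polyhedron_extreme_point_ge _ _ _ G b l (allocations N)) => //.
- case=> [[j|k]|k] c x y /=; first by rewrite !mxE; ring.
    exact: caplin.
  by case: ifP => _; rewrite ?caplin; ring.
- move=> d Gd; apply: capacity_recession => [j|k].
    by have := Gd (inl (inl j)); rewrite /= oppr_le0.
  exact: Gd (inl (inr k)).
move=> x; split.
  move=> [x0 x1 xI] [[j|k]|k] /=; first by rewrite oppr_le0.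
    exact: x1.
  by case: ifP => // kI; rewrite /cap xI.
move=> H; split=> [j|k|k kI].
- by have := H (inl (inl j)); rewrite /= oppr_le0.
- exact: H (inl (inr k)).
- apply/eqP; rewrite eq_le; apply/andP; split; first exact: H (inl (inr k)).
  by have := H (inr k); rewrite /= kI lerN2.
Qed.

(** Input activities use only input processors and service activities only service processors, so in
    each constraint one of the two sums vanishes and both families take a single form. *)
Lemma dual_feasibleE (y : 'cV[R]_nI) (z : 'cV[R]_nK) : dual_feasible N (y, z) <->
  [/\ forall j, \sum_(i < nI) y i 0 * io_matrix N i j <=
        \sum_(k < nK | k \notin KI) z k 0 * A k j - \sum_(k < nK | k \in KI) z k 0 * A k j,
      \sum_(k < nK | k \notin KI) z k 0 = 1
    & forall k, k \notin KI -> 0 <= z k 0].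
Proof.
have A0 k j : (j \in JI) != (k \in KI) -> A k j = 0.
  by case: (capacity01 Nax k j) => // /(capacity_compat Nax) ->; rewrite eqxx.
have SI j : j \in JI -> \sum_(k < nK | k \notin KI) z k 0 * A k j = 0.
  by move=> jI; rewrite big1// => k kI; rewrite A0 ?mulr0// jI (negbTE kI).
have SS j : j \notin JI -> \sum_(k < nK | k \in KI) z k 0 * A k j = 0.
  by move=> jI; rewrite big1// => k kI; rewrite A0 ?mulr0// (negbTE jI) kI.
split=> [[/= HI HS z1 z0]|[H z1 z0]]; split=> // j.
- by have [jI|jI] := boolP (j \in JI); [rewrite SI// sub0r HI|rewrite SS// subr0 HS].
- by move=> jI /=; have := H j; rewrite SI// sub0r.
- by move=> jI /=; have := H j; rewrite SS// subr0.
Qed.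

(** Pair the dual constraints with [x] and exchange the sums. The flow [io_matrix N *m x] is left
    arbitrary, so that the bound also applies to the workload drift of an allocation. *)
Lemma weak_duality y z rho (x : 'cV[R]_nJ) : dual_feasible N (y, z) ->
  (forall j, 0 <= x j 0) ->
  (forall k, k \in KI -> \sum_(j < nJ) A k j * x j 0 = 1) ->
  (forall k, k \notin KI -> \sum_(j < nJ) A k j * x j 0 <= rho) ->
  dotprod y (io_matrix N *m x) <= rho - dual_value N (y, z).
Proof.
move=> /dual_feasibleE[H z1 z0] x0 xI xS.
have -> : dotprod y (io_matrix N *m x) =
    \sum_(j < nJ) (\sum_(i < nI) y i 0 * io_matrix N i j) * x j 0.
  rewrite /dotprod; under eq_bigr do rewrite mxE mulr_sumr.
  rewrite exchange_big/=; apply: eq_bigr => j _; rewrite mulr_suml.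
  by apply: eq_bigr => i _; rewrite mulrA.
apply: (@le_trans _ _ (\sum_(j < nJ) (\sum_(k < nK | k \notin KI) z k 0 * A k j
    - \sum_(k < nK | k \in KI) z k 0 * A k j) * x j 0)).
  by apply: ler_sum => j _; rewrite ler_wpM2r.
have swap (P : pred 'I_nK) : \sum_(j < nJ) (\sum_(k < nK | P k) z k 0 * A k j) * x j 0 =
    \sum_(k < nK | P k) z k 0 * \sum_(j < nJ) A k j * x j 0.
  under eq_bigr do rewrite mulr_suml.
  rewrite exchange_big/=; apply: eq_bigr => k _; rewrite mulr_sumr.
  by apply: eq_bigr => j _; rewrite mulrA.
under eq_bigr do rewrite mulrBl.
rewrite sumrB !swap lerB//.
  rewrite -[leRHS]mul1r -z1 mulr_suml; apply: ler_sum => k kS.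
  by rewrite ler_wpM2l ?z0 ?xS.
by rewrite /dual_value/=; apply: ler_sum => k kI; rewrite xI// mulr1.
Qed.

End NetworkDuality.

(** * Strong duality and its consequences for workload and flow directions *)

Section PlanningDuality.
Context {R : realType} {nI nJ nK : nat} (N : network R nI nJ nK).
Hypothesis Nax : network_axioms N.

Local Notation A := (capacity N).
Local Notation KI := (input_proc N).
Local Notation JI := (input_act N).

(** Farkas' lemma for the homogenized planning problem: if [x >= 0] has zero flow, input loads equal
    to [t] and service loads at most [r], then [t <= r]. The multipliers certifying this form a dual
    point of value 1. *)
Lemma strong_duality xs ys zs : planning_optimal N (1, xs) ->
  dual_feasible N (ys, zs) -> exists2 q, dual_feasible N q & 1 <= dual_value N q.
Proof.
move=> [[_ _ _ _] xopt] [_ _ zs1 _].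
pose sg (s : bool) : R := if s then 1 else -1.
pose X := ('I_nJ + bool)%type.
(* Coordinates [inl j], [inr true] and [inr false] stand for the activity level [j], for [t] and for
   [r]. An equality is entered as two inequalities of opposite signs [sg s]. *)
pose g (i : ('I_nI * bool + 'I_nK * bool) + 'I_nJ) (p : X) : R := match i with
  | inl (inl (i, s)) => if p is inl j then sg s * io_matrix N i j else 0
  | inl (inr (k, s)) =>
      if k \in KI then match p with
        | inl j => sg s * A k j | inr true => - sg s | inr false => 0 end
      else if s then match p with
        | inl j => A k j | inr true => 0 | inr false => -1 end
      else 0
  | inr j => if p is inl j' then - (j' == j)%:R else 0
  end.
pose gam (p : X) : R := match p with
  inl j => 0 | inr true => 1 | inr false => -1 end.
have sumX (f : X -> R) : \sum_p f p = \sum_(j < nJ) f (inl j) + (f (inr true) + f (inr false)).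
  by rewrite big_sumType big_bool.
have pairE n (f : 'I_n * bool -> R) : \sum_q f q = \sum_(i < n) (f (i, true) + f (i, false)).
  rewrite [RHS](eq_bigr (fun i => \sum_s f (i, s))) => [|i _]; last by rewrite big_bool.
  by rewrite pair_bigA; apply: eq_bigr => -[].
have [x Hx|w w0 wE] := @farkas R _ _ g gam.
  rewrite sumX/= big1 => [|j _]; last by rewrite mul0r.
  set t := x (inr true); set r := x (inr false).
  pose xv : 'cV[R]_nJ := \col_j x (inl j).
  have x0 j : 0 <= x (inl j).
    have := Hx (inr j); rewrite sumX/= !mul0r !addr0.
    rewrite (bigD1 j)//= eqxx big1 => [|j' /negbTE->]; last by rewrite oppr0 mul0r.
    by rewrite addr0 mulN1r oppr_le0.
  have Rx : io_matrix N *m xv = 0.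
    apply/matrixP => i i0; rewrite mxE [RHS]mxE; under eq_bigr do rewrite [xv _ _]mxE.
    apply/eqP; rewrite eq_le; apply/andP; split.
      have := Hx (inl (inl (i, true))); rewrite sumX/= !mul0r !addr0.
      by under eq_bigr do rewrite mul1r.
    have := Hx (inl (inl (i, false))); rewrite sumX/= !mul0r !addr0.
    under eq_bigr do rewrite mulN1r mulNr.
    by rewrite sumrN oppr_le0.
  have xI k : k \in KI -> \sum_(j < nJ) A k j * x (inl j) = t.
    move=> kI; apply/eqP; rewrite eq_le; apply/andP; split.
      have := Hx (inl (inr (k, true))); rewrite sumX/= kI !mul0r !addr0.
      by under eq_bigr do rewrite mul1r; rewrite mulN1r subr_le0.
    have := Hx (inl (inr (k, false))); rewrite sumX/= kI !mul0r !addr0.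
    under eq_bigr do rewrite mulN1r mulNr.
    by rewrite sumrN opprK mul1r addrC subr_le0.
  have xS k : k \notin KI -> \sum_(j < nJ) A k j * x (inl j) <= r.
    move=> /negbTE kI; have := Hx (inl (inr (k, true))).
    by rewrite sumX/= kI !mul0r add0r mulN1r subr_le0.
  have Ax0 k : 0 <= \sum_(j < nJ) A k j * x (inl j).
    by apply: sumr_ge0 => j _; rewrite mulr_ge0// capacity_ge0.
  (* The normalization of [zs] guarantees that some service processor exists; its load is
     nonnegative and at most [r]. *)
  have r0 : 0 <= r.
    have [k kS|nS] := pickP (fun k => k \notin KI); first exact: le_trans (xS k kS).
    by move/eqP: zs1; rewrite big_pred0// eq_sym oner_eq0.
  have [t0|t0] := leP t 0; first by rewrite add0r mul1r mulN1r subr_le0 (le_trans t0).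
  (* For [t > 0], division by [t] gives a feasible planning point, whose objective [r / t] is at
     least the optimum 1. *)
  have := xopt (r / t, t^-1 *: xv); rewrite /= ler_pdivlMr// mul1r => tr.
  rewrite add0r mulN1r subr_le0 tr//; split=> /=.
  - by rewrite -scalemxAr Rx scaler0.
  - move=> k kI; under eq_bigr do rewrite !mxE mulrCA.
    by rewrite -mulr_sumr xI// mulVf// gt_eqF.
  - move=> k kS; under eq_bigr do rewrite !mxE mulrCA.
    by rewrite -mulr_sumr mulrC ler_pM2r ?invr_gt0// xS.
  - by move=> j; rewrite !mxE mulr_ge0// invr_ge0 ltW.
pose u k := w (inl (inr (k, true))) - w (inl (inr (k, false))).
pose y : 'cV[R]_nI := \col_i (w (inl (inl (i, false))) - w (inl (inl (i, true)))).
pose z : 'cV[R]_nK := \col_k (if k \in KI then - u k else w (inl (inr (k, true)))).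
(* Paired multipliers combine into the free variables. Coordinate [inr false] then gives the
   normalization, [inr true] the value 1, and [inl j] the dual constraint with slack [w (inr j)]. *)
have {}wE p : gam p =
    \sum_(i < nI) - y i 0 * g (inl (inl (i, true))) p +
    \sum_(k < nK | k \in KI) - z k 0 * g (inl (inr (k, true))) p +
    \sum_(k < nK | k \notin KI) z k 0 * g (inl (inr (k, true))) p +
    \sum_(j < nJ) w (inr j) * g (inr j) p.
  rewrite wE big_sumType/=; congr (_ + _); rewrite big_sumType/= -addrA; congr (_ + _).
    rewrite pairE; apply: eq_bigr => i _; rewrite !mxE /sg/=.
    by case: p => [j|b] /=; ring.
  rewrite pairE (bigID (fun k => k \in KI))/=; congr (_ + _); apply: eq_bigr => k kI.
    rewrite !mxE/= kI /u /sg.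
    by case: p => [j|[]] /=; ring.
  by rewrite !mxE/= (negbTE kI) /=; case: p => [j|[]] /=; ring.
have z1 : \sum_(k < nK | k \notin KI) z k 0 = 1.
  have := wE (inr false); rewrite /= [X in X + _ + _ + _]big1 => [|i _]; last by rewrite mulr0.
  rewrite [X in _ + X + _ + _]big1 => [|k kI]; last by rewrite kI mulr0.
  rewrite [X in _ + X]big1 => [|j _]; last by rewrite mulr0.
  rewrite !add0r addr0 (eq_bigr (fun k => - z k 0)) => [|k /negbTE->]; last by rewrite mulrN1.
  by rewrite sumrN => /oppr_inj.
have zv : \sum_(k < nK | k \in KI) z k 0 = 1.
  have := wE (inr true); rewrite /= [X in X + _ + _ + _]big1 => [|i _]; last by rewrite mulr0.
  rewrite [X in _ + X + _]big1 => [|k /negbTE->]; last by rewrite mulr0.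
  rewrite [X in _ + X]big1 => [|j _]; last by rewrite mulr0.
  rewrite !add0r !addr0 (eq_bigr (fun k => z k 0)) => [//|k ->].
  by rewrite mulrNN mulr1.
exists (y, z); last by rewrite /dual_value/= zv.
apply/(dual_feasibleE Nax); split=> // [j|k /negbTE kI]; last by rewrite mxE kI.
have := wE (inl j); rewrite /=.
rewrite (eq_bigr (fun i => - (y i 0 * io_matrix N i j))) => [|i _]; last by ring.
rewrite (eq_bigr (fun k => - (z k 0 * A k j))) => [|k ->]; last by ring.
rewrite [X in _ + _ + X + _](eq_bigr (fun k => z k 0 * A k j)); last first.
  by move=> k /negbTE->.
have : 0 <= w (inr j) by [].
rewrite (bigD1 j)//= eqxx [X in _ + (_ + X)]big1 => [|i /negbTE]; last first.
  by rewrite eq_sym => ->; rewrite oppr0 mulr0.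
rewrite !sumrN mulr1n; lra.
Qed.

(** Weak duality with [rho = 1], the optimal dual value being at least 1 by strong duality. *)
Lemma dual_drift_le0 xs ys zs a : planning_optimal N (1, xs) ->
  dual_optimal N (ys, zs) -> allocations N a -> dotprod ys (io_matrix N *m a) <= 0.
Proof.
move=> xopt [yf yopt] [a0 a1 aI].
have [q qf q1] := strong_duality xopt yf.
apply: le_trans (weak_duality Nax yf a0 aI (fun k _ => a1 k)) _.
by rewrite subr_le0 (le_trans q1)// yopt.
Qed.

(* If v violates the Farkas condition, (ys + v, zs + z)/(1 + S) is again dual
   optimal, so uniqueness makes v a multiple of ys, hence orthogonal to w. *)
Lemma balanced_direction xs ys zs (w : 'cV[R]_nI) :
  planning_optimal N (1, xs) -> dual_optimal N = [set (ys, zs)] ->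
  dotprod ys w = 0 ->
  exists2 tau, 0 <= tau & exists2 a, allocations N a & w = tau *: (io_matrix N *m a).
Proof.
move=> [[Rxs xsI xsS xs0] _] dopt yw.
have [yf yopt] : dual_optimal N (ys, zs) by rewrite dopt.
have xsA : allocations N xs.
  split=> // k; have [kI|kS] := boolP (k \in KI); first by rewrite xsI.
  exact: xsS.
have vle1 : dual_value N (ys, zs) <= 1.
  have := weak_duality Nax yf xs0 xsI xsS; rewrite /= Rxs.
  by rewrite /dotprod big1 ?subr_ge0// => i _; rewrite mxE mulr0.
(* The multipliers sought are an activity vector [a] with flow [w], a common load [tau] of the input
   processors, and the slacks of the service processors below [tau]. *)
pose g (i : ('I_nJ + unit) + 'I_nK) (p : 'I_nI + 'I_nK) : R := match i, p with
  | inl (inl j), inl i => io_matrix N i j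
  | inl (inl j), inr k => A k j
  | inl (inr _), inl _ => 0
  | inl (inr _), inr _ => -1
  | inr k, inl _ => 0
  | inr k, inr k' => ((k' == k) && (k \notin KI))%:R
  end.
pose gam (p : 'I_nI + 'I_nK) : R := if p is inl i then w i 0 else 0.
have [x Hx|c c0 cE] := @farkas R _ _ g gam.
  rewrite big_sumType/= [X in _ + X]big1 ?addr0 => [|k _]; last by rewrite mul0r.
  pose v : 'cV[R]_nI := \col_i x (inl i).
  pose u k := x (inr k).
  have uS k : k \notin KI -> u k <= 0.
    move=> kS; have := Hx (inr k); rewrite big_sumType/= big1 => [|i _]; last by rewrite mul0r.
    rewrite add0r (bigD1 k)//= eqxx kS mul1r big1 ?addr0// => k' /negbTE->.
    by rewrite mul0r.
  have u0 : 0 <= \sum_k u k.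
    have := Hx (inl (inr tt)); rewrite big_sumType/= big1 => [|i _]; last by rewrite mul0r.
    by rewrite add0r -mulr_sumr mulN1r oppr_le0.
  have uj j : \sum_i io_matrix N i j * v i 0 + \sum_k A k j * u k <= 0.
    have := Hx (inl (inl j)); rewrite big_sumType/=; congr (_ + _ <= 0).
    by apply: eq_bigr => i _; rewrite [v _ _]mxE.
  rewrite (bigID (fun k => k \in KI))/= in u0.
  (* The service components of [zs] plus the perturbation sum to [1 + S], hence the division by
     [1 + S]. *)
  pose S := - \sum_(k < nK | k \notin KI) u k.
  have S0 : 0 <= S by rewrite oppr_ge0 sumr_le0.
  have S10 : 0 < 1 + S by rewrite ltr_pwDl.
  pose y := (1 + S)^-1 *: (ys + v).
  pose z : 'cV[R]_nK := (1 + S)^-1 *: (zs + \col_k (if k \in KI then u k else - u k)).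
  have zI (f : 'I_nK -> R) : \sum_(k < nK | k \in KI) z k 0 * f k = (1 + S)^-1 *
      (\sum_(k < nK | k \in KI) zs k 0 * f k + \sum_(k < nK | k \in KI) u k * f k).
    rewrite -big_split/= mulr_sumr; apply: eq_bigr => k kI.
    by rewrite !mxE kI; ring.
  have zS (f : 'I_nK -> R) : \sum_(k < nK | k \notin KI) z k 0 * f k = (1 + S)^-1 *
      (\sum_(k < nK | k \notin KI) zs k 0 * f k - \sum_(k < nK | k \notin KI) u k * f k).
    rewrite -sumrB mulr_sumr; apply: eq_bigr => k /negbTE kI.
    by rewrite !mxE kI; ring.
  have sum1 (P : pred 'I_nK) (h : 'I_nK -> R) : \sum_(k | P k) h k = \sum_(k | P k) h k * 1.
    by apply: eq_bigr => k _; rewrite mulr1.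
  have /(dual_feasibleE Nax)[ysj zs1 zs0] := yf.
  have opt : dual_optimal N (y, z).
    split.
      apply/(dual_feasibleE Nax); split=> [j||k kS].
      - rewrite zI zS -mulrBr.
        have -> : \sum_i y i 0 * io_matrix N i j = (1 + S)^-1 *
            (\sum_i ys i 0 * io_matrix N i j + \sum_i io_matrix N i j * v i 0).
          rewrite -big_split/= mulr_sumr; apply: eq_bigr => i _.
          by rewrite 2![in LHS]mxE; ring.
        rewrite ler_pM2l ?invr_gt0//.
        have := uj j; rewrite (bigID (fun k => k \in KI))/=.
        have uA (P : pred 'I_nK) : \sum_(k | P k) A k j * u k = \sum_(k | P k) u k * A k j.
          by apply: eq_bigr => k _; rewrite mulrC.
        by rewrite !uA; have := ysj j; lra.
      - by rewrite sum1 zS -!sum1 zs1 mulVf// gt_eqF.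
      - rewrite !mxE (negbTE kS) mulr_ge0 ?invr_ge0 ?(ltW S10)//.
        by rewrite addr_ge0 ?zs0// oppr_ge0 uS.
    (* The perturbation adds at least [S] to the value, because [u] has a nonnegative total. As the
       old value is at most 1, dividing by [1 + S] does not bring it below the old one. *)
    move=> q qf; apply: le_trans (yopt q qf) _.
    rewrite {2}/dual_value/= sum1 zI -!sum1 -/(dual_value N (ys, zs)).
    have uIS : S <= \sum_(k < nK | k \in KI) u k by move: u0; rewrite /S; lra.
    rewrite ler_pdivlMl// mulrDl mul1r lerD2l (le_trans _ uIS)//.
    by rewrite ler_piMr.
  move: opt; rewrite dopt => -[yE _].
  have -> : \sum_i w i 0 * x (inl i) = S * dotprod ys w.
    rewrite /dotprod mulr_sumr; apply: eq_bigr => i _.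
    have : v = S *: ys.
      have : (1 + S) *: y = (1 + S) *: ys by rewrite yE.
      rewrite scalerA mulfV ?gt_eqF// scale1r scalerDl scale1r.
      by move=> /addrI.
    by move=> /matrixP/(_ i 0); rewrite !mxE => ->; ring.
  by rewrite yw mulr0.
pose tau := c (inl (inr tt)).
pose a : 'cV[R]_nJ := \col_j c (inl (inl j)).
have wE : w = io_matrix N *m a.
  apply/matrixP => i i0; rewrite (ord1 i0); have := cE (inl i); rewrite /= => ->.
  rewrite big_sumType/= big_sumType/= (big_pred1 tt) => [|[]//].
  rewrite mulr0 addr0 [X in _ + X]big1 => [|k _]; last by rewrite mulr0.
  by rewrite addr0 mxE; apply: eq_bigr => j _; rewrite [a _ _]mxE mulrC.
have aE k : \sum_(j < nJ) A k j * a j 0 + c (inr k) * (k \notin KI)%:R = tau.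
  have := cE (inr k); rewrite /= big_sumType/= big_sumType/= (big_pred1 tt) => [|[]//].
  rewrite (bigD1 k)//= eqxx/= [X in _ + (_ + X)]big1 => [|k' /negbTE]; last first.
    by rewrite eq_sym => ->; rewrite mulr0.
  rewrite (eq_bigr (fun j => A k j * a j 0)) => [|j _]; last by rewrite [a _ _]mxE mulrC.
  rewrite -/tau; lra.
have a0 j : 0 <= a j 0 by rewrite mxE.
have aI k : k \in KI -> \sum_(j < nJ) A k j * a j 0 = tau.
  by move=> kI; rewrite -(aE k) kI mulr0 addr0.
have aS k : \sum_(j < nJ) A k j * a j 0 <= tau.
  by rewrite -(aE k) lerDl mulr_ge0// ler0n.
have tau0 : 0 <= tau by exact: c0.
(* If [tau = 0], then [a] loads no processor and vanishes, so [w = 0] and any allocation serves;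
   [xs] is one. *)
move: tau0; rewrite le_eqVlt => /predU1P[tau0|tau0].
  exists 0 => //; exists xs => //; rewrite scale0r wE.
  by rewrite (capacity_recession Nax a0) ?mulmx0// => k; rewrite [leRHS]tau0.
exists tau; first exact: ltW.
exists (tau^-1 *: a); last by rewrite -scalemxAr scalerA mulfV ?gt_eqF// scale1r.
have sE k : \sum_(j < nJ) A k j * (tau^-1 *: a) j 0 = tau^-1 * \sum_(j < nJ) A k j * a j 0.
  by rewrite mulr_sumr; apply: eq_bigr => j _; rewrite [(_ *: a) _ _]mxE; ring.
split=> [j|k|k kI].
- by rewrite mxE mulr_ge0// invr_ge0 ltW.
- by rewrite sE ler_pdivrMl// mulr1.
- by rewrite sE aI// mulVf// gt_eqF.
Qed.

End PlanningDuality.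

(** * The Lyapunov function *)

Section Lyapunov.
Context {R : realType} {nI : nat} (alpha y : 'cV[R]_nI).
Hypothesis alpha_gt0 : forall i, 0 < alpha i 0.

Definition deviation (z : 'cV[R]_nI) : 'cV[R]_nI :=
  z - dotprod y z *: lifting alpha y.

Definition lyapunov (z : 'cV[R]_nI) : R :=
  \sum_(i < nI) alpha i 0 * deviation z i 0 ^+ 2.

Let S := \sum_(i < nI) (y i 0 ^+ 2 / alpha i 0).

Lemma deviationE z i :
  deviation z i 0 = z i 0 - dotprod y z * (y i 0 / alpha i 0 / S).
Proof. by rewrite !mxE. Qed.

Lemma lyapunov_term_ge0 z i : 0 <= alpha i 0 * deviation z i 0 ^+ 2.
Proof. by rewrite mulr_ge0 ?sqr_ge0 ?ltW. Qed.

Lemma lyapunov_ge0 z : 0 <= lyapunov z.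
Proof. by apply: sumr_ge0 => i _; exact: lyapunov_term_ge0. Qed.

Lemma lyapunov_eq0 z : (lyapunov z == 0) = (deviation z == 0).
Proof.
apply/idP/eqP => [|z0]; last first.
  by rewrite /lyapunov big1// => i _; rewrite z0 mxE expr0n mulr0.
rewrite psumr_eq0 => [|i _]; last exact: lyapunov_term_ge0.
move=> /allP H; apply/matrixP => i j; rewrite (ord1 j) [RHS]mxE.
have := H i (mem_index_enum _); rewrite /= mulf_eq0 sqrf_eq0 gt_eqF//= => /eqP.
exact.
Qed.

Lemma dotprod_deviation z : dotprod y (deviation z) = 0.
Proof.
rewrite /dotprod; under eq_bigr do rewrite deviationE mulrBr mulrCA.
rewrite sumrB -mulr_sumr.
have -> : \sum_i y i 0 * (y i 0 / alpha i 0 / S) = S / S.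
  by rewrite {1}/S mulr_suml; apply: eq_bigr => i _; ring.
(* With [S = 0] the quotient [S / S] is 0 rather than 1, but then [y = 0] because the weights are
   positive. *)
have [S0|S0] := eqVneq S 0; last by rewrite mulfV// mulr1 subrr.
rewrite S0 mul0r mulr0 subr0 big1// => i _.
have yi t : 'I_nI -> 0 <= y t 0 ^+ 2 / alpha t 0.
  by move=> _; rewrite divr_ge0 ?sqr_ge0 ?ltW.
move/eqP: S0; rewrite /S psumr_eq0 => [/allP/(_ i (mem_index_enum _))|t _]; last exact: yi.
by rewrite /= mulf_eq0 invr_eq0 sqrf_eq0 (gt_eqF (alpha_gt0 i)) orbF => /eqP->; rewrite mul0r.
Qed.

(** The vectors [alpha x q] and [alpha x z], with [q] the deviation of [z], differ by a multiple of
    [y], to which [q] is orthogonal. This expresses the Lyapunov function as a pressure in direction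
    [q]. *)
Lemma lyapunov_dotprod z : lyapunov z = dotprod (deviation z) (cmul alpha z).
Proof.
have -> : lyapunov z = dotprod (deviation z) (cmul alpha z) -
    dotprod y z / S * dotprod y (deviation z).
  rewrite /lyapunov /dotprod [X in _ = _ - X]mulr_sumr -sumrB; apply: eq_bigr => i _.
  rewrite expr2 [in X in _ * (_ * X)]deviationE [cmul _ _ _ _]mxE -/(dotprod y z).
  by move: S^-1 => k; field; rewrite gt_eqF.
by rewrite dotprod_deviation mulr0 subr0.
Qed.

Lemma lyapunovE z : lyapunov z =
  \sum_(i < nI) alpha i 0 * z i 0 ^+ 2 - S^-1 * dotprod y z ^+ 2.
Proof.
rewrite lyapunov_dotprod /dotprod.
rewrite expr2 mulrA mulr_sumr -sumrB; apply: eq_bigr => i _.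
rewrite deviationE [cmul _ _ _ _]mxE -/(dotprod y z).
by move: S^-1 => k; field; rewrite gt_eqF.
Qed.

Lemma lyapunov_le z : lyapunov z <= \sum_(i < nI) alpha i 0 * z i 0 ^+ 2.
Proof.
rewrite lyapunovE gerBl mulr_ge0 ?sqr_ge0 ?invr_ge0//.
by apply: sumr_ge0 => i _; rewrite divr_ge0 ?sqr_ge0 ?ltW.
Qed.

Lemma deviation_le z i :
  `|deviation z i 0| <= Num.sqrt (alpha i 0)^-1 * Num.sqrt (lyapunov z).
Proof.
rewrite -sqrtrM; last by rewrite invr_ge0 ltW.
rewrite -sqrtr_sqr.
apply: ler_wsqrtr; rewrite ler_pdivlMl//.
rewrite /lyapunov (bigD1 i)//= lerDl sumr_ge0// => j _.
exact: lyapunov_term_ge0.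
Qed.

End Lyapunov.

(** * Lower bound on the maximum pressure *)

Section Pressure.
Context {R : realType} {nI nJ nK : nat} (N : network R nI nJ nK).
Hypothesis Nax : network_axioms N.
Variables (alpha ys : 'cV[R]_nI) (xs : 'cV[R]_nJ) (zs : 'cV[R]_nK).
Hypothesis alpha_gt0 : forall i, 0 < alpha i 0.
Hypothesis xopt : planning_optimal N (1, xs).
Hypothesis dopt : dual_optimal N = [set (ys, zs)].

(** Each [w i] and its opposite is a bounded multiple of the flow of an allocation, so its pressure
    is at most [D * M] in absolute value. Summing against the deviation gives
    [f <= C * D * M * sqrt f], to be divided by [sqrt f]. *)
Lemma pressure_ge : exists2 kappa, 0 < kappa & forall z M,
  (forall e, extreme_points (allocations N) e ->
     dotprod (io_matrix N *m e) (cmul alpha z) <= M) ->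
  kappa * Num.sqrt (lyapunov alpha ys z) <= M.
Proof.
(* The vectors w i are the projections of the unit vectors on the orthogonal
   of ys, so that q = \sum_i q_i w_i for the deviation q. *)
pose w (i : 'I_nI) : 'cV[R]_nI :=
  delta_mx i 0 - (ys i 0 / dotprod ys ys) *: ys.
have dotB (u v v' : 'cV[R]_nI) c : dotprod u (v - c *: v') = dotprod u v - c * dotprod u v'.
  by rewrite /dotprod mulr_sumr -sumrB; apply: eq_bigr => i _; rewrite !mxE; ring.
have dotC (u v : 'cV[R]_nI) : dotprod u v = dotprod v u.
  by apply: eq_bigr => i _; rewrite mulrC.
have dotZ (u v : 'cV[R]_nI) c : dotprod u (c *: v) = c * dotprod u v.
  by rewrite /dotprod mulr_sumr; apply: eq_bigr => i _; rewrite !mxE; ring.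
have dotdelta (u : 'cV[R]_nI) i : dotprod u (delta_mx i 0) = u i 0.
  rewrite /dotprod (bigD1 i)//= big1 => [|j /negbTE ji]; last by rewrite mxE ji mulr0.
  by rewrite mxE !eqxx mulr1 addr0.
have yw i : dotprod ys (w i) = 0.
  rewrite /w dotB dotdelta.
  have [y0|y0] := eqVneq (dotprod ys ys) 0; last by rewrite divfK// subrr.
  rewrite y0 mulr0 subr0; move/eqP: y0; rewrite psumr_eq0 => [|j _]; last first.
    by rewrite -expr2 sqr_ge0.
  by move=> /allP/(_ i (mem_index_enum _)); rewrite mulf_eq0 orbb => /eqP.
have /choice[tau tauP] : forall p : 'I_nI * bool, exists tau, 0 <= tau /\
    exists2 a, allocations N a & (-1) ^+ p.2 *: w p.1 = tau *: (io_matrix N *m a).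
  move=> [i s] /=; have [|tau tau0 H] := balanced_direction Nax xopt dopt (w := (-1) ^+ s *: w i).
    by rewrite dotZ yw mulr0.
  by exists tau.
pose D := 1 + \sum_p tau p.
have D0 : 0 < D by rewrite ltr_pwDl// sumr_ge0// => p _; case: (tauP p).
have tauD p : tau p <= D.
  rewrite /D (bigD1 p)//= addrCA lerDl addr_ge0// sumr_ge0// => q _.
  by case: (tauP q).
pose C := 1 + \sum_i Num.sqrt (alpha i 0)^-1.
have C0 : 0 < C by rewrite ltr_pwDl// sumr_ge0// => p _; rewrite sqrtr_ge0.
exists (C * D)^-1; first by rewrite invr_gt0 mulr_gt0.
move=> z M HM.
have aM a : allocations N a -> dotprod (io_matrix N *m a) (cmul alpha z) <= M.
  move=> Aa.
  have [|e /HM eM le] := @allocation_extreme_ge _ _ _ _ N Nax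
    (fun a => dotprod (io_matrix N *m a) (cmul alpha z)) a _ Aa.
    move=> c x x' /=; rewrite mulmxDr -scalemxAr /dotprod mulr_sumr -big_split/=.
    by apply: eq_bigr => i _; rewrite [in LHS]mxE [X in (X + _) * _]mxE; ring.
  exact: le_trans le eM.
(* The allocation [xs] has zero flow, hence zero pressure. *)
have M0 : 0 <= M.
  have [[/= Rxs xsI xsS xs0] _] := xopt.
  have /aM : allocations N xs.
    split=> // k; have [kI|kS] := boolP (k \in input_proc N); first by rewrite xsI.
    exact: xsS.
  by rewrite Rxs /dotprod big1// => i _; rewrite mxE mul0r.
have wM i : `|dotprod (w i) (cmul alpha z)| <= D * M.
  have wsM s : (-1) ^+ nat_of_bool s * dotprod (w i) (cmul alpha z) <= D * M.
    have [t0 [a Aa /= aE]] := tauP (i, s).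
    rewrite [dotprod (w i) _]dotC -dotZ aE dotZ dotC.
    apply: (@le_trans _ _ (tau (i, s) * M)); first by rewrite ler_wpM2l// aM.
    by rewrite ler_wpM2r.
  by rewrite ler_norml lerNl -mulN1r (wsM true) -[X in X <= _]mul1r (wsM false).
set q := deviation alpha ys z; set f := lyapunov alpha ys z.
have fE : f = \sum_i q i 0 * dotprod (w i) (cmul alpha z).
  rewrite /f lyapunov_dotprod// -/q.
  transitivity (\sum_i (q i 0 * cmul alpha z i 0 -
      ys i 0 * q i 0 * (dotprod (cmul alpha z) ys / dotprod ys ys))).
    rewrite sumrB -mulr_suml -/(dotprod ys q) dotprod_deviation//.
    by rewrite mul0r subr0.
  apply: eq_bigr => i _; rewrite [dotprod (w i) _]dotC /w dotB dotdelta.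
  by ring.
have fle : f <= C * D * M * Num.sqrt f.
  rewrite fE; apply: (@le_trans _ _ (\sum_i `|q i 0| * (D * M))).
    apply: ler_sum => i _; apply: le_trans (ler_norm _) _.
    by rewrite normrM ler_wpM2l.
  rewrite -mulr_suml -fE.
  have -> : C * D * M * Num.sqrt f = C * Num.sqrt f * (D * M) by ring.
  rewrite ler_wpM2r ?mulr_ge0 ?(ltW D0)// /C mulrDl mul1r mulr_suml.
  apply: (@le_trans _ _ (\sum_i Num.sqrt (alpha i 0)^-1 * Num.sqrt f)).
    by apply: ler_sum => i _; exact: deviation_le.
  by rewrite lerDr sqrtr_ge0.
rewrite ler_pdivrMl ?mulr_gt0//.
have [f0|f0] := leP f 0; first by rewrite ler0_sqrtr// !mulr_ge0 ?(ltW C0) ?(ltW D0).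
rewrite -(ler_pM2r (x := Num.sqrt f)) ?sqrtr_gt0//.
by rewrite -expr2 sqr_sqrtr ?(ltW f0).
Qed.

End Pressure.

(** * Fluid trajectories *)

Lemma is_derive1_sum (R : realType) (n : nat) (h : 'I_n -> R -> R) (dh : 'I_n -> R) (x : R) :
  (forall i, is_derive x (1:R) (h i) (dh i)) ->
  is_derive x (1:R) (fun t => \sum_(i < n) h i t) (\sum_(i < n) dh i).
Proof.
move=> hh; rewrite (_ : (fun _ => _) = \sum_(i < n) h i); first exact: is_derive_sum.
by apply/funext => t; rewrite fct_sumE.
Qed.

Lemma is_derive1_scale (R : realType) (c : R) (f : R -> R) (x df : R) :
  is_derive x (1:R) f df -> is_derive x (1:R) (fun t => c * f t) (c * df).
Proof. by move=> fdf; apply: (is_deriveZ c). Qed.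

Lemma is_derive1_sqr (R : realType) (f : R -> R) (x df : R) :
  is_derive x (1:R) f df -> is_derive x (1:R) (fun t => f t ^+ 2) (2 * f x * df).
Proof.
move=> fdf; have := is_deriveX 2 fdf.
by rewrite /GRing.scale/= expr1.
Qed.

Lemma nondecreasing_derive_ge0 (R : realType) (f : R -> R) (a x : R) : a < x ->
  (forall s t, a <= s -> s <= t -> f s <= f t) ->
  derivable f x 1 -> 0 <= 'D_1 f x.
Proof.
move=> ax nd df; apply: limr_ge => //; near=> h.
have h0 : h != 0 by near: h; exact: nbhs_dnbhs_neq.
have hx : `|h| < x - a by near: h; apply: dnbhs0_lt; rewrite subr_gt0.
rewrite /= [_%:A]mulr1; have [hp|hn] := ltP 0 h.
  by rewrite mulr_ge0 ?invr_ge0 ?(ltW hp)// subr_ge0 nd ?lerDr ?(ltW hp) ?(ltW ax).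
rewrite mulr_le0 ?invr_le0// subr_le0 nd// ?gerDr//.
by move: hx; rewrite ler0_norm//; lra.
Unshelve. all: by end_near. Qed.

Section FluidLyapunov.
Context {R : realType} {nI nJ nK : nat} (N : network R nI nJ nK).
Hypothesis Nax : network_axioms N.
Variables (alpha ys : 'cV[R]_nI) (xs : 'cV[R]_nJ) (zs : 'cV[R]_nK).
Hypothesis alpha_gt0 : forall i, 0 < alpha i 0.
Hypothesis xopt : planning_optimal N (1, xs).
Hypothesis dopt : dual_optimal N = [set (ys, zs)].
Hypothesis ys_ge0 : forall i, 0 <= ys i 0.
Variables (Z : R -> 'cV[R]_nI) (T : R -> 'cV[R]_nJ).
Hypothesis fluid : fluid_solution N alpha Z T.

Let W t := dotprod ys (Z t).
Let phi t := lyapunov alpha ys (Z t).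

(** Activity [j] loads some processor at unit rate, and the capacity of that processor bounds the
    increment. *)
Lemma fluid_increment s t j : 0 <= s -> s <= t -> 0 <= T t j 0 - T s j 0 <= t - s.
Proof.
move=> s0 st; have T0 i : 0 <= T t i 0 - T s i 0.
  by rewrite subr_ge0 (fluid_nondecreasing fluid).
rewrite T0/=; have [k Akj] := capacity_col_neq0 Nax j.
apply: le_trans (fluid_capacity fluid s0 st k).
rewrite (bigD1 j)//=; have [/eqP|->] := capacity01 Nax k j; first by rewrite (negbTE Akj).
rewrite mul1r lerDl sumr_ge0// => i _.
by rewrite mulr_ge0// capacity_ge0.
Qed.

Lemma fluid_T_lipschitz a b : 0 <= a -> forall i j, lipschitz_itv a b (fun t => T t i j).
Proof.
move=> a0 i j; rewrite (ord1 j); exists 1 => //.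
have H x y : 0 <= x -> x <= y -> `|T y i 0 - T x i 0| <= 1 * `|y - x|.
  move=> x0 xy; have /andP[h1 h2] := fluid_increment i x0 xy.
  by rewrite mul1r (ger0_norm h1) ger0_norm// subr_ge0.
move=> x y; rewrite !in_itv/= => /andP[ax _] /andP[ay _].
have [xy|/ltW yx] := leP x y; first by rewrite H// (le_trans a0).
by rewrite distrC [X in _ * X]distrC H// (le_trans a0).
Qed.

Lemma fluid_ZE t i : 0 <= t ->
  Z t i 0 = Z 0 i 0 + \sum_(j < nJ) - io_matrix N i j * T t j 0.
Proof.
move=> t0; rewrite (fluid_balance fluid t0).
have -> (u v : 'cV[R]_nI) : (u - v) i 0 = u i 0 - v i 0 by rewrite !mxE.
by rewrite mxE -sumrN; congr (_ + _); apply: eq_bigr => j _; rewrite mulNr.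
Qed.

Lemma fluid_Z_lipschitz a b i : 0 <= a -> lipschitz_itv a b (fun t => Z t i 0).
Proof.
move=> a0; apply: (@eq_lipschitz_itv _ _ _
    (fun t => Z 0 i 0 + \sum_(j < nJ) - io_matrix N i j * T t j 0)).
  by move=> t; rewrite in_itv/= => /andP[ta _]; rewrite -fluid_ZE// (le_trans a0).
apply: lipschitz_itvD; first exact: lipschitz_itv_cst.
apply: lipschitz_itv_sum => j; apply: lipschitz_itvM; first exact: lipschitz_itv_cst.
exact: fluid_T_lipschitz.
Qed.

Lemma fluid_workload_ge0 t : 0 <= t -> 0 <= W t.
Proof.
by move=> t0; apply: sumr_ge0 => i _; rewrite mulr_ge0// (fluid_ge0 fluid).
Qed.

(** The average activity rate [(T t - T s) / (t - s)] is itself an allocation, so its workload drift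
    is nonpositive; no derivative is involved. *)
Lemma fluid_workload_nondecreasing s t : 0 <= s -> s <= t -> W s <= W t.
Proof.
move=> s0; rewrite le_eqVlt => /predU1P[->//|st].
have t0 := le_trans s0 (ltW st).
have ts0 : 0 < t - s by rewrite subr_gt0.
have incE k : \sum_(j < nJ) capacity N k j * ((t - s)^-1 *: (T t - T s)) j 0 =
    (t - s)^-1 * \sum_(j < nJ) capacity N k j * (T t j 0 - T s j 0).
  by rewrite mulr_sumr; apply: eq_bigr => j _; rewrite !mxE; ring.
have Aa : allocations N ((t - s)^-1 *: (T t - T s)).
  split=> [j|k|k kI].
  - rewrite !mxE mulr_ge0 ?invr_ge0 ?(ltW ts0)//.
    by have /andP[] := fluid_increment j s0 (ltW st).
  - by rewrite incE ler_pdivrMl// mulr1 (fluid_capacity fluid) ?(ltW st).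
  - by rewrite incE (fluid_input_busy fluid) ?(ltW st)// mulVf// gt_eqF.
have yopt : dual_optimal N (ys, zs) by rewrite dopt.
have := dual_drift_le0 Nax xopt yopt Aa.
have -> : dotprod ys (io_matrix N *m ((t - s)^-1 *: (T t - T s))) = (t - s)^-1 * (W s - W t).
  rewrite -scalemxAr mulmxBr /W (fluid_balance fluid t0) (fluid_balance fluid s0).
  move: (_ *m T t) (_ *m T s) => u v.
  by rewrite /dotprod -sumrB mulr_sumr; apply: eq_bigr => i _; rewrite !mxE; ring.
by rewrite pmulr_rle0 ?invr_gt0// subr_le0.
Qed.

Lemma fluid_lyapunov_lipschitz a b : 0 <= a -> lipschitz_itv a b phi.
Proof.
move=> a0; set S := \sum_(i < nI) (ys i 0 ^+ 2 / alpha i 0).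
rewrite (_ : phi = fun t => \sum_(i < nI) alpha i 0 * (Z t i 0 * Z t i 0) +
   - S^-1 * (W t * W t)); last first.
  by apply/funext => t; rewrite /phi lyapunovE// -/S mulNr -/(W t) expr2.
have Zl i := fluid_Z_lipschitz b i a0.
have Wl : lipschitz_itv a b W.
  apply: lipschitz_itv_sum => i; apply: lipschitz_itvM => //; exact: lipschitz_itv_cst.
apply: lipschitz_itvD.
  apply: lipschitz_itv_sum => i; apply: lipschitz_itvM; first exact: lipschitz_itv_cst.
  exact: lipschitz_itvM.
by apply: lipschitz_itvM; [exact: lipschitz_itv_cst|exact: lipschitz_itvM].
Qed.

(** On nonnegative times [Z] is affine in [T], so differentiability of [T] at [t > 0] already makes
    [t] a regular time. *)
Lemma fluid_derivative t : 0 < t -> derivable T t 1 -> derivable Z t 1 /\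
  forall i, is_derive t (1:R) (fun x => Z x i 0) (- (io_matrix N *m 'D_1 T t) i 0).
Proof.
move=> t0 dT.
have dTj j : is_derive t (1:R) (fun x => T x j 0) ('D_1 T t j 0).
  rewrite derive_mx// mxE; apply/derivableP.
  by move/derivable_mxP : dT; exact.
have dZ i : is_derive t (1:R) (fun x => Z x i 0) (- (io_matrix N *m 'D_1 T t) i 0).
  apply: (@near_eq_is_derive _ _ _
    (fun x => Z 0 i 0 + \sum_(j < nJ) - io_matrix N i j * T x j 0)).
    near=> x; rewrite -fluid_ZE//.
    by apply: ltW; near: x; exact: lt_nbhsr.
  rewrite mxE -sumrN -[X in is_derive _ _ _ X]add0r.
  apply: is_deriveD; apply: is_derive1_sum => j.
  rewrite -mulNr; exact: is_derive1_scale.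
split=> //; apply/derivable_mxP => i j; rewrite (ord1 j).
exact: ex_derive.
Unshelve. all: by end_near. Qed.

(** The derivative is [- 2 M - 2 W W' / S], where [M] is the maximum pressure and both [W] and [W']
    are nonnegative. *)
Lemma fluid_lyapunov_derivative kappa t :
  (forall z M, (forall e, extreme_points (allocations N) e ->
      dotprod (io_matrix N *m e) (cmul alpha z) <= M) ->
    kappa * Num.sqrt (lyapunov alpha ys z) <= M) ->
  0 < t -> derivable T t 1 ->
  exists2 d, is_derive t (1:R) phi d & d <= - (2 * kappa * Num.sqrt (phi t)).
Proof.
move=> kP t0 dT; have [dZ dZi] := fluid_derivative t0 dT.
set S := \sum_(i < nI) (ys i 0 ^+ 2 / alpha i 0).
pose dW := \sum_(i < nI) ys i 0 * - (io_matrix N *m 'D_1 T t) i 0.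
have dWP : is_derive t (1:R) W dW.
  by apply: is_derive1_sum => i; exact: is_derive1_scale.
have dW0 : 0 <= dW.
  rewrite -[dW](@derive_val _ _ _ _ _ _ _ dWP).
  apply: (nondecreasing_derive_ge0 t0); last exact: ex_derive.
  exact: fluid_workload_nondecreasing.
pose M := dotprod (io_matrix N *m 'D_1 T t) (cmul alpha (Z t)).
have [_ Mub] := fluid_max_pressure fluid t0 dZ dT.
have kM : kappa * Num.sqrt (phi t) <= M.
  by apply: kP => e ee; apply: Mub; exists e.
exists (\sum_(i < nI) alpha i 0 * (2 * Z t i 0 * - (io_matrix N *m 'D_1 T t) i 0)
  + - S^-1 * (2 * W t * dW)).
  rewrite (_ : phi = fun t => \sum_(i < nI) alpha i 0 * (Z t i 0 ^+ 2) +
     - S^-1 * (W t ^+ 2)); last first.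
    by apply/funext => x; rewrite /phi lyapunovE// -/S mulNr.
  apply: is_deriveD.
    by apply: is_derive1_sum => i; apply: is_derive1_scale; exact: is_derive1_sqr.
  by apply: is_derive1_scale; exact: is_derive1_sqr.
have -> : \sum_(i < nI) alpha i 0 * (2 * Z t i 0 * - (io_matrix N *m 'D_1 T t) i 0) = - 2 * M.
  rewrite /M /dotprod mulr_sumr; apply: eq_bigr => i _.
  by rewrite [cmul _ _ _ _]mxE; ring.
have : 0 <= S^-1 * (2 * W t * dW).
  rewrite !mulr_ge0 ?invr_ge0 ?fluid_workload_ge0 ?(ltW t0)//.
  by apply: sumr_ge0 => i _; rewrite divr_ge0 ?sqr_ge0 ?ltW.
move: kM; lra.
Qed.

(** * Decay of the Lyapunov function to zero in finite time *)

Section Decay.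
Variable kappa : R.
Hypothesis kappa_gt0 : 0 < kappa.
Hypothesis kappaP : forall z M, (forall e, extreme_points (allocations N) e ->
      dotprod (io_matrix N *m e) (cmul alpha z) <= M) ->
    kappa * Num.sqrt (lyapunov alpha ys z) <= M.

Lemma fluid_lyapunov_nonincreasing s t : 0 <= s -> s <= t -> phi t <= phi s.
Proof.
move=> s0 st; rewrite -subr_le0 -(mul0r (t - s)).
apply: (lipschitz_derive_le (u := T) st (fluid_T_lipschitz t s0)
  (fluid_lyapunov_lipschitz t s0)) => x.
rewrite in_itv/= => /andP[sx _] dT.
have [d dphi dle] := fluid_lyapunov_derivative kappaP (le_lt_trans s0 sx) dT.
split; first exact: ex_derive.
rewrite (@derive_val _ _ _ _ _ _ _ dphi) (le_trans dle)// oppr_le0.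
by rewrite !mulr_ge0 ?sqrtr_ge0 ?(ltW kappa_gt0).
Qed.

(** By monotonicity [phi] stays at least [phi t > 0] on [[0, t]]. There its square root is Lipschitz
    and has derivative at most [- kappa] at regular times; integrate. *)
Lemma fluid_lyapunov_gt0_time t : 0 <= t -> 0 < phi t ->
  kappa * t <= Num.sqrt (phi 0).
Proof.
move=> t0 pt; have phit x : x \in `[0, t] -> phi t <= phi x.
  by rewrite in_itv/= => /andP[x0 xt]; exact: fluid_lyapunov_nonincreasing.
suff : Num.sqrt (phi t) - Num.sqrt (phi 0) <= - kappa * (t - 0).
  by have := sqrtr_ge0 (phi t); lra.
apply: (lipschitz_derive_le (u := T) t0 (fluid_T_lipschitz t (lexx 0))
  (lipschitz_itv_sqrt pt phit (fluid_lyapunov_lipschitz t (lexx 0)))) => x xt dT.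
have := xt; rewrite in_itv/= => /andP[x0 _].
have px : 0 < phi x by rewrite (lt_le_trans pt)// phit//; exact: subset_itv_oo_cc.
have [d dphi dle] := fluid_lyapunov_derivative kappaP x0 dT.
have dsq := is_derive1_comp (is_derive1_sqrt px) dphi.
split; first exact: (@ex_derive _ _ _ _ _ _ _ dsq).
rewrite (@derive_val _ _ _ _ _ _ _ dsq) ler_pdivrMl ?mulr_gt0 ?sqrtr_gt0//.
by move: dle; lra.
Qed.

End Decay.

End FluidLyapunov.

(** * Uniformity of the constants and the conclusion *)

Lemma network_data_eq (R : realType) (nI nJ nK : nat) (N N' : network R nI nJ nK) :
  input_act N = input_act N' -> input_proc N = input_proc N' ->
  io_matrix N = io_matrix N' -> capacity N = capacity N' ->
  allocations N = allocations N' /\ dual_optimal N = dual_optimal N'.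
Proof.
by move=> EJ EK ER EA; rewrite /allocations /dual_optimal /dual_feasible /dual_value
  EJ EK ER EA.
Qed.

(* The data (Rio, A) and the sets JI, KI determine the dual program, hence ys:
   a constant obtained for one network serves all networks sharing them. *)
Lemma uniform_pressure (R : realType) (nI nJ nK : nat) (alpha : 'cV[R]_nI)
    (Rio : 'M[R]_(nI, nJ)) (A : 'M[R]_(nK, nJ)) (JI : {set 'I_nJ}) (KI : {set 'I_nK}) :
  (forall i, 0 < alpha i 0) ->
  exists kappa : R, 0 < kappa /\
    forall (N : network R nI nJ nK) xs ys zs,
      network_axioms N -> input_act N = JI -> input_proc N = KI ->
      io_matrix N = Rio -> capacity N = A ->
      planning_optimal N (1, xs) -> dual_optimal N = [set (ys, zs)] ->
      forall z M, (forall e, extreme_points (allocations N) e ->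
          dotprod (io_matrix N *m e) (cmul alpha z) <= M) ->
        kappa * Num.sqrt (lyapunov alpha ys z) <= M.
Proof.
move=> alpha0.
pose data (N : network R nI nJ nK) xs ys zs :=
  network_axioms N /\ [/\ input_act N = JI, input_proc N = KI,
    io_matrix N = Rio & capacity N = A] /\
  planning_optimal N (1, xs) /\ dual_optimal N = [set (ys, zs)].
have [[N [xs [ys [zs [Nax [[EJ EK ER EA] [xopt dopt]]]]]]]|none] :=
    pselect (exists N xs ys zs, data N xs ys zs); last first.
  (* With no network for these data the claim is vacuous and any positive constant serves. *)
  exists 1; split=> // N xs ys zs Nax EJ EK ER EA xopt dopt.
  by exfalso; apply: none; exists N, xs, ys, zs.
have [kappa kappa0 kP] := pressure_ge Nax alpha0 xopt dopt.
exists kappa; split=> // N' xs' ys' zs' _ EJ' EK' ER' EA' _ dopt' z M.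
have [allocE dualE] : allocations N' = allocations N /\ dual_optimal N' = dual_optimal N.
  by apply: network_data_eq; rewrite ?EJ' ?EK' ?ER' ?EA'.
have [<- _] : [set (ys', zs')] (ys, zs) by rewrite -dopt' dualE dopt.
rewrite allocE ER' -ER; exact: kP.
Qed.

Theorem theorem6 (R : realType) (nI nJ nK : nat) (alpha : 'cV[R]_nI)
    (Rio : 'M[R]_(nI, nJ)) (A : 'M[R]_(nK, nJ)) :
  (forall i, 0 < alpha i 0) ->
  exists tau0 : R, 0 < tau0 /\
    forall (N : network R nI nJ nK) (rhos : R) (xs : 'cV[R]_nJ)
           (ys : 'cV[R]_nI) (zs : 'cV[R]_nK),
      network_axioms N -> io_matrix N = Rio -> capacity N = A ->
      planning_optimal N = [set (rhos, xs)] -> rhos = 1 ->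
      dual_optimal N = [set (ys, zs)] ->
      (forall i, 0 <= ys i 0) -> (forall k, 0 <= zs k 0) ->
      forall (Z : R -> 'cV[R]_nI) (T : R -> 'cV[R]_nJ),
        fluid_solution N alpha Z T -> `|Z 0| <= 1 ->
        (forall t : R, tau0 <= t ->
           `|Z t - workload ys Z t *: lifting alpha ys| = 0) /\
        (forall tau1 : R, 0 <= tau1 ->
           `|Z tau1 - workload ys Z tau1 *: lifting alpha ys| = 0 ->
           forall t : R, tau1 <= t ->
             `|Z t - workload ys Z t *: lifting alpha ys| = 0).
Proof.
move=> alpha0.
(* The constant [kappa] also depends on which activities and processors are inputs. There are
   finitely many such choices, so summing over them leaves a bound depending only on [alpha], [Rio]
   and [A]. *)
have /choice[kap kapP] := fun p : {set 'I_nJ} * {set 'I_nK} =>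
  uniform_pressure Rio A p.1 p.2 alpha0.
pose F := Num.sqrt (\sum_(i < nI) alpha i 0).
have term0 p : 0 <= F / kap p.
  by rewrite divr_ge0 ?sqrtr_ge0// ltW//; case: (kapP p).
(* The added 1 makes the time positive and strictly larger than every [F / kap p], where [F] bounds
   the root of the initial Lyapunov value. *)
exists (1 + \sum_p F / kap p); split; first by rewrite ltr_pwDl// sumr_ge0.
move=> N rhos xs ys zs Nax ER EA xoptE rhos1 dopt ys0 _ Z T fluid Z01.
have xopt : planning_optimal N (1, xs) by rewrite xoptE rhos1.
have [k0 /(_ N xs ys zs Nax erefl erefl ER EA xopt dopt) kP] :=
  kapP (input_act N, input_proc N).
have devE t : (`|Z t - workload ys Z t *: lifting alpha ys| = 0) <->
    lyapunov alpha ys (Z t) = 0.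
  split=> [/eqP|/eqP]; first by rewrite normr_eq0 -lyapunov_eq0// => /eqP.
  by rewrite lyapunov_eq0// => /eqP dev0; apply/eqP; rewrite normr_eq0; apply/eqP.
split=> [t tau_t|tau1 tau10 /devE phi0 t tau1t]; apply/devE; last first.
  apply/eqP; rewrite eq_le lyapunov_ge0// andbT -phi0.
  exact: (fluid_lyapunov_nonincreasing Nax alpha0 xopt dopt ys0 fluid k0 kP).
have t0 : 0 <= t by apply: le_trans tau_t; rewrite addr_ge0 ?sumr_ge0.
apply/eqP; rewrite eq_le lyapunov_ge0// andbT leNgt; apply/negP => phit.
have := fluid_lyapunov_gt0_time Nax alpha0 xopt dopt ys0 fluid k0 kP t0 phit.
apply/negP; rewrite -ltNge.
have phi0F : Num.sqrt (lyapunov alpha ys (Z 0)) <= F.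
  apply: ler_wsqrtr; apply: le_trans (lyapunov_le ys alpha0 (Z 0)) _.
  apply: ler_sum => i _; rewrite ler_piMr ?(ltW (alpha0 i))// -real_normK ?num_real//.
  rewrite exprn_ile1//; apply: le_trans Z01.
  rewrite [leRHS]/Num.Def.normr/= mx_normrE.
  exact: (le_bigmax _ (fun ij => `|Z 0 ij.1 ij.2|) (i, 0)).
apply: le_lt_trans phi0F _; rewrite mulrC -ltr_pdivrMr//.
apply: lt_le_trans tau_t; rewrite (bigD1 (input_act N, input_proc N))//=.
by rewrite addrCA ltrDl ltr_pwDl// sumr_ge0.
Qed.
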